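(* Let $n\geq 3$ be an integer. There are constants $C_n,c_n>0$, depending only on $n$, such that for each real number $\gamma\geq 1$, setting $K_\gamma = C_n\gamma$, there exist a measurable symmetric matrix field $A_\gamma\in L^\infty(\mathbb{B}^n,\mathrm{Sym}_n)$ satisfying $$\frac{1}{K_\gamma}|\xi|^2\leq A_\gamma(x)\xi\cdot\xi\leq K_\gamma|\xi|^2\qquad\text{for a.e. } x\in\mathbb{B}^n \text{ and all } \xi\in\mathbb{R}^n,$$ a real number $\alpha_\gamma>0$, and a positively $\alpha_\gamma$-homogeneous function $u_\gamma\in W^{1,2}(\mathbb{B}^n)$, not identically zero, which is a weak solution of $$\operatorname{div}(A_\gamma\,\mathrm{D}u_\gamma)=0\quad\text{in }\mathbb{B}^n,$$ and such that $$\alpha_\gamma\leq \exp(-c_nK_\gamma).$$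
   Context: $\mathbb{B}^n$ is the open unit ball of $\mathbb{R}^n$ centred at the origin, and $\mathrm{Sym}_n$ is the space of real symmetric $n\times n$ matrices. $\mathrm{D}u$ denotes the (weak) gradient of $u$. A function $u\in W^{1,2}(\mathbb{B}^n)$ is a weak solution of $\operatorname{div}(A\,\mathrm{D}u)=0$ in $\mathbb{B}^n$, for bounded measurable $A$, if $\int_{\mathbb{B}^n}A\,\mathrm{D}u\cdot\mathrm{D}\zeta\,dx=0$ for all $\zeta\in C_c^\infty(\mathbb{B}^n)$. A function $u$ is positively $\alpha$-homogeneous if $u(tx)=t^\alpha u(x)$ for all $t>0$ and $x\neq 0$ with $x,tx\in\mathbb{B}^n$. *)

(* Defs.v *)
From HB Require Import structures.
From mathcomp Require Import all_boot all_order all_algebra.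
From mathcomp Require Import all_classical all_reals all_analysis.

Set Implicit Arguments.
Unset Strict Implicit.
Unset Printing Implicit Defensive.

Import Order.TTheory GRing.Theory Num.Theory.
Import numFieldNormedType.Exports.

Local Open Scope classical_set_scope.
Local Open Scope ring_scope.

(* The sigma-algebra on R^n generated by the coordinates, i.e. the Borel one. *)
Section borel_rV.
Context {R : realType} {n : nat}.

Let coord (i : 'I_n) (x : 'rV[R]_n) : measurableTypeR R := x ord0 i.

Let rV_set0 : g_sigma_preimage coord set0.
Proof. exact: sigma_algebra0. Qed.

Let rV_setC A : g_sigma_preimage coord A -> g_sigma_preimage coord (~` A).
Proof. exact: sigma_algebraC. Qed.

Let rV_bigcup (F : (set 'rV[R]_n)^nat) :
  (forall i, g_sigma_preimage coord (F i)) ->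
  g_sigma_preimage coord (\bigcup_i F i).
Proof. exact: sigma_algebra_bigcup. Qed.

HB.instance Definition _ :=
  @isMeasurable.Build (measure_tuple_display (R.-ocitv.-measurable).-sigma)
    'rV[R]_n (g_sigma_preimage coord) rV_set0 rV_setC rV_bigcup.

Lemma measurable_coord_rV (i : 'I_n) :
  measurable_fun [set: 'rV[R]_n] (fun x => x ord0 i : measurableTypeR R).
Proof.
move=> _ Y mY; rewrite setTI; apply: sub_sigma_algebra => /=.
rewrite -bigcup_seq/=; exists i => /=; first by rewrite mem_index_enum.
by exists Y => //; rewrite setTI.
Qed.

Lemma measurable_fun_rV d (T : measurableType d) (f : T -> 'rV[R]_n) :
  (forall i, measurable_fun setT (fun x => f x ord0 i : measurableTypeR R)) ->
  measurable_fun setT f.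
Proof.
move=> mf; apply: (@measurability _ _ _ _ _ _
  (\big[setU/set0]_(i < n) preimage_set_system setT (coord i) measurable)) => //.
move=> _ [B + <-]; rewrite -bigcup_seq/= => -[i _] [C mC <-].
by rewrite setTI; have := mf i measurableT C mC; rewrite !setTI.
Qed.

End borel_rV.

Section lebesgue_rV.
Context {R : realType}.
Implicit Types n : nat.

Definition consrV n (p : measurableTypeR R * 'rV[R]_n) : 'rV[R]_n.+1 :=
  \row_i oapp (fun j => p.2 ord0 j) p.1 (unlift ord0 i).

Definition unconsrV n (x : 'rV[R]_n.+1) : measurableTypeR R * 'rV[R]_n :=
  (x ord0 ord0, \row_j x ord0 (lift ord0 j)).

Lemma consrVK n : cancel (@consrV n) (@unconsrV n).
Proof.
move=> [t x]; rewrite /unconsrV /consrV mxE unlift_none/=; congr pair.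
by apply/rowP => j; rewrite !mxE liftK.
Qed.

Lemma unconsrVK n : cancel (@unconsrV n) (@consrV n).
Proof.
move=> x; apply/rowP => i; rewrite mxE.
by case: unliftP => [j|] -> //=; rewrite mxE.
Qed.

Lemma measurable_consrV n : measurable_fun setT (@consrV n).
Proof.
apply: measurable_fun_rV => i.
under eq_fun do rewrite mxE.
case: (unlift ord0 i) => [j|] /=; last exact: measurable_fst.
exact: (measurableT_comp (measurable_coord_rV j) measurable_snd).
Qed.

Lemma measurable_unconsrV n : measurable_fun setT (@unconsrV n).
Proof.
apply/measurable_fun_pairP; split; first exact: measurable_coord_rV.
apply: measurable_fun_rV => j.
under eq_fun do rewrite mxE.
exact: measurable_coord_rV.
Qed.

Section succ.
Variables (n : nat) (mu : {sigma_finite_measure set 'rV[R]_n -> \bar R}).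

Definition lebesgue_rV_succ : set 'rV[R]_n.+1 -> \bar R :=
  pushforward (lebesgue_measure \x mu)%E (@consrV n).

HB.instance Definition _ := Measure.copy lebesgue_rV_succ
  (measure_function_pushforward__canonical__measure_function_Measure
    (lebesgue_measure \x mu)%E (@measurable_consrV n)).

Let sigma_finite_succ : sigma_finite setT lebesgue_rV_succ.
Proof.
have /sigma_finiteP[F [TF ndF Foo]] := sigma_finiteT (@lebesgue_measure R).
have /sigma_finiteP[G [TG ndG Goo]] := sigma_finiteT mu.
exists (fun k => @unconsrV n @^-1` (F k `*` G k)).
  rewrite -preimage_bigcup (_ : \bigcup_k _ = setT) ?preimage_setT//.
  rewrite -setXTT TF TG; apply/seteqP; split=> [[t x] [k _ []]|[t x]] /=.
    by move=> Ft Gx; split; exists k.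
  move=> [[k _ Ft] [l _ Gx]]; exists (maxn k l) => //; split.
    by move: t Ft; exact/subsetPset/ndF/leq_maxl.
  by move: x Gx; exact/subsetPset/ndG/leq_maxr.
move=> k; have [mF Fk] := Foo k; have [mG Gk] := Goo k; split.
  rewrite -[X in measurable X]setTI; apply: measurable_unconsrV => //.
  exact: measurableX.
rewrite /lebesgue_rV_succ /pushforward -comp_preimage.
rewrite (_ : _ \o _ = id); last by apply/funext => p; rewrite /= consrVK.
by rewrite product_measure1E// lte_mul_pinfty// ge0_fin_numE.
Qed.

HB.instance Definition _ := Measure_isSigmaFinite.Build _ _ _
  lebesgue_rV_succ sigma_finite_succ.

End succ.

Fixpoint lebesgue_rV n : {sigma_finite_measure set 'rV[R]_n -> \bar R} :=
  match n with
  | 0 => [the {sigma_finite_measure set 'rV[R]_0 -> \bar R} of \d_(0 : 'rV[R]_0)]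
  | n'.+1 => [the {sigma_finite_measure set 'rV[R]_n'.+1 -> \bar R} of
               lebesgue_rV_succ (lebesgue_rV n')]
  end.

(* Boxes generate the Borel sigma-algebra, so this determines [lebesgue_rV n]. *)
Lemma lebesgue_rV_box n (A : 'I_n -> set (measurableTypeR R)) :
  (forall i, measurable (A i)) ->
  lebesgue_rV n [set x | forall i, A i (x ord0 i)] =
  (\prod_(i < n) lebesgue_measure (A i))%E.
Proof.
elim: n A => [|n IHn] A mA.
  by rewrite big_ord0 /= diracE mem_set// => -[].
rewrite big_ord_recl -IHn// -product_measure1E//; last first.
  rewrite [X in measurable X](_ : _ = \big[setI/setT]_(i < n)
    ((fun x : 'rV[R]_n => x ord0 i) @^-1` A (lift ord0 i))).
    apply: bigsetI_measurable => i _; rewrite -[X in measurable X]setTI.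
    exact: measurable_coord_rV.
  by rewrite -bigcap_seq; apply/seteqP; split=> x /= Ax i;
    [move=> _; exact: Ax|apply: Ax; rewrite /= mem_index_enum].
congr ((lebesgue_measure \x lebesgue_rV n)%E _).
apply/seteqP; split=> [[t x]/= Ax|[t x]/= [At Ax] i].
  split=> [|i]; first by have := Ax ord0; rewrite mxE unlift_none.
  by have := Ax (lift ord0 i); rewrite mxE liftK.
by rewrite mxE; case: unliftP => [j|] ->.
Qed.

End lebesgue_rV.

Section euclidean.
Context {R : realType} {n : nat}.
Implicit Types (x v w : 'rV[R]_n) (A : 'M[R]_n).

Definition dotrV v w : R := \sum_i v ord0 i * w ord0 i.

(* [`|v|] is the sup norm on matrices, hence a separate Euclidean norm. *)
Definition enorm v : R := Num.sqrt (dotrV v v).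

Definition unit_ball : set 'rV[R]_n := [set x | enorm x < 1].

(* The product A v, where v is seen as a column vector. *)
Definition mulmxrV A v : 'rV[R]_n := (A *m v^T)^T.

Definition partial (i : 'I_n) (f : 'rV[R]_n -> R) : 'rV[R]_n -> R :=
  fun x => 'D_(delta_mx ord0 i) f x.

Definition grad (f : 'rV[R]_n -> R) x : 'rV[R]_n := \row_i partial i f x.

(* C^oo: every iterated partial derivative is Frechet differentiable. *)
Definition smooth (f : 'rV[R]_n -> R) : Prop :=
  forall (s : seq 'I_n) x, differentiable (foldr partial f s) x.

(* C_c^oo(Omega), with functions extended by 0 to the whole space. *)
Definition test_function (Omega : set 'rV[R]_n) (f : 'rV[R]_n -> R) : Prop :=
  let supp := closure [set x | f x != 0] in
  [/\ smooth f, compact supp & supp `<=` Omega].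

End euclidean.

Section sobolev.
Context {R : realType} {n : nat}.
Implicit Types (Omega : set 'rV[R]_n) (u : 'rV[R]_n -> R).
Implicit Types (Du : 'rV[R]_n -> 'rV[R]_n) (A : 'rV[R]_n -> 'M[R]_n).

Local Notation leb := (@lebesgue_rV R n).

(* L^p(Omega); the values of [u] outside Omega are irrelevant. *)
Definition Lp_on (p : \bar R) Omega u : Prop := u \_ Omega \in Lfun leb p.

Definition weak_gradient Omega u Du : Prop :=
  forall phi, test_function Omega phi -> forall i : 'I_n,
    (\int[leb]_(x in Omega) (u x * partial i phi x)%:E =
     - \int[leb]_(x in Omega) (Du x ord0 i * phi x)%:E)%E.

Definition sobolev12_grad Omega u Du : Prop :=
  [/\ Lp_on 2%:E Omega u, forall i, Lp_on 2%:E Omega (fun x => Du x ord0 i) &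
      weak_gradient Omega u Du].

Definition sobolev12 Omega u : Prop := exists Du, sobolev12_grad Omega u Du.

(* Weak solution in W^{1,2}(Omega) of div(A Du) = 0 in Omega.  The weak gradient
   is unique up to null sets, so the choice of [Du] is immaterial. *)
Definition weak_solution Omega A u : Prop :=
  exists2 Du, sobolev12_grad Omega u Du &
    forall zeta, test_function Omega zeta ->
      (\int[leb]_(x in Omega)
         (dotrV (mulmxrV (A x) (Du x)) (grad zeta x))%:E = 0)%E.

(* L^oo(Omega, Sym_n) *)
Definition Linfty_sym Omega A : Prop :=
  (forall i j, Lp_on +oo%E Omega (fun x => A x i j)) /\
  (forall x, Omega x -> (A x)^T = A x).

Definition elliptic Omega A (K : R) : Prop :=
  \forall x \ae leb, Omega x -> forall xi : 'rV[R]_n,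
    K^-1 * enorm xi ^+ 2 <= dotrV (mulmxrV (A x) xi) xi <= K * enorm xi ^+ 2.

Definition pos_homogeneous Omega (alpha : R) u : Prop :=
  forall (t : R) x, 0 < t -> x != 0 -> Omega x -> Omega (t *: x) ->
    u (t *: x) = t `^ alpha * u x.

End sobolev.

(* Main.v *)
Require Import Defs.
From mathcomp Require Import all_boot all_order all_algebra.
From mathcomp Require Import all_classical all_reals all_analysis.
From mathcomp Require Import measurable_realfun ess_sup_inf ring lra.

(* Write r = |x|, t = x_1 / r, G(t) = tanh (k t), b = 1 - G^2 and
   alpha = exp (- 2k), with k = gamma, and let u = r^alpha G(t).
     The vector field
     F = r^(alpha - 1) (a(t) x / r + b(t) e_1),
     a = ((1 - alpha) t b + 2 k G b (1 - t^2)) / (n - 2 + alpha),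
   is divergence free away from 0; here n - 2 > 0 turns the radial flux into a
   drift of size k towards the two poles t = 1 and t = -1, and as in a
   double-well problem the exponent alpha is exponentially small in k.
   A pointwise computation gives |F|^2 + |Du|^2 <= 100 k F.Du, and this is all
   that is needed for a symmetric matrix A with A Du = F to exist with
   eigenvalues between 1 / (300 k) and 300 k.
   Since u, F and their derivatives are O(r^-2), which is integrable for n >= 3,
   the singularity at 0 is invisible to integration by parts: almost no line
   parallel to an axis meets it. *)

Set Implicit Arguments.
Unset Strict Implicit.
Unset Printing Implicit Defensive.

Import Order.TTheory GRing.Theory Num.Theory.
Import numFieldNormedType.Exports.

Local Open Scope classical_set_scope.
Local Open Scope ring_scope.

(** * Measurability and integration on row vectors *)

Section measurability.
Context {R : realType} {n : nat}.
Implicit Types (x y : 'rV[R]_n) (f g : 'rV[R]_n -> R).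

Lemma measurable_box (A : 'I_n -> set (measurableTypeR R)) :
  (forall i, measurable (A i)) ->
  measurable [set x : 'rV[R]_n | forall i, A i (x ord0 i)].
Proof.
move=> mA; rewrite [X in measurable X](_ : _ = \big[setI/setT]_(i < n)
    ((fun x : 'rV[R]_n => x ord0 i) @^-1` A i)).
  apply: bigsetI_measurable => i _; rewrite -[X in measurable X]setTI.
  exact: measurable_coord_rV.
by rewrite -bigcap_seq; apply/seteqP; split=> x /= Ax i;
  [move=> _; exact: Ax|apply: Ax; rewrite /= mem_index_enum].
Qed.

(** Rational boxes form a countable base: [U] is the union of the boxes with rational centre and
    radius [1/(k+1)] that it contains. *)
Lemma open_measurable_rV (U : set 'rV[R]_n) : open U -> measurable U.
Proof.
move=> oU.
pose box (p : 'rV[rat]_n * nat) : set 'rV[R]_n :=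
  [set x | forall i, ball (ratr (p.1 ord0 i) : R) p.2.+1%:R^-1 (x ord0 i)].
have mbox p : measurable (box p).
  apply: (@measurable_box (fun i =>
    ball (ratr (p.1 ord0 i) : R) p.2.+1%:R^-1)) => i.
  exact: measurable_ball.
rewrite (_ : U = \bigcup_p (if `[< box p `<=` U >] then box p else set0)).
  apply: countable_bigcupT_measurable => [|p]; first exact: countableP.
  by case: ifP.
apply/seteqP; split => [x Ux|x [p _]]; last by case: asboolP => // + px; exact.
have /nbhs_ballP[e /= e0 xeU] : nbhs x U by move: oU; rewrite openE; exact.
(* The radius [1/(k+1)] bounds both the distance from [x] to the centre and the distance from the
   centre to [y], hence the factor 2. *)
have [k ke] : exists k : nat, 2 * k.+1%:R^-1 < e.
  have /ltr_add_invr[k] : 0 < e / 2 by rewrite divr_gt0.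
  by rewrite add0r ltr_pdivlMr// mulrC => ?; exists k.
have k0 : (0 : R) < k.+1%:R^-1 by rewrite invr_gt0.
have xq i : exists q : rat, `|x ord0 i - ratr q| < k.+1%:R^-1.
  have : x ord0 i - k.+1%:R^-1 < x ord0 i + k.+1%:R^-1.
    by move: k0; set d := _^-1 => ?; lra.
  move=> /rat_in_itvoo[q]; rewrite in_itv/= => /andP[? ?]; exists q.
  by rewrite distrC ltr_distl; apply/andP.
pose q := \row_i sval (cid (xq i)).
have xqE i : `|x ord0 i - ratr (q ord0 i)| < k.+1%:R^-1.
  by rewrite mxE; case: cid.
exists (q, k) => //; case: asboolP => [_ i|[]].
  by rewrite /ball/= distrC xqE.
move=> y /= qy; apply: xeU; split=> // i j; rewrite ord1 /ball/=.
have := ler_distD (ratr (q ord0 j)) (x ord0 j) (y ord0 j).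
have /ltW := qy j; rewrite [leLHS]/= [leRHS]/= => yq; have := xqE j => xq'.
move: ke yq xq'; set d := _^-1 => ke yq xq' /le_lt_trans; apply; lra.
Qed.

(* Only {0} escapes the continuity hypothesis, and points are measurable. *)
Lemma measurable_fun_continuous_off0 f :
  (forall x, x != 0 -> {for x, continuous f}) -> measurable_fun setT f.
Proof.
move=> cf; apply: (measurability (@RGenOpens.G R)).
  exact: RGenOpens.measurableE.
move=> _ [_ [a [b ->] <-]]; rewrite setTI; set V := _ @^-1` _.
have m0 : measurable [set 0 : 'rV[R]_n].
  rewrite (_ : [set 0] = [set x : 'rV[R]_n | forall i, [set 0] (x ord0 i)]).
    exact: (@measurable_box (fun=> [set 0])).
  apply/seteqP; split => x /=; first by move=> -> i; rewrite mxE.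
  by move=> x0; apply/rowP => i; rewrite mxE x0.
rewrite -(setUIDK V [set 0]); apply: measurableU; last first.
  apply: open_measurable_rV; rewrite openE => x [Vx /= /eqP x0].
  apply: filterI.
    by apply: (cf _ x0); apply: open_nbhs_nbhs; split.
  apply: (@open_nbhs_nbhs _ x (~` [set 0])); split; last exact/eqP.
  apply: closed_openC.
  exact: (accessible_closed_set1 (hausdorff_accessible (@norm_hausdorff _ _))).
have [V0|V0] := pselect (V 0).
  by rewrite (_ : _ `&` _ = [set 0])//; apply/seteqP; split => [x []|x /= ->].
rewrite (_ : _ `&` _ = set0)//; apply/seteqP; split => // x [] + /= xE.
by rewrite xE.
Qed.

Lemma continuous_measurable_rV f : continuous f -> measurable_fun setT f.
Proof. by move=> cf; apply: measurable_fun_continuous_off0 => x _;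
  exact: cf. Qed.

End measurability.

(** * Fubini along lines parallel to an axis *)

Section fubini_rV.
Context {R : realType}.
Implicit Types n : nat.
Local Notation mu1 := (@lebesgue_measure R).
Local Notation leb := (@lebesgue_rV R).

Definition update_rV n (x : 'rV[R]_n) (i : 'I_n) (t : R) : 'rV[R]_n :=
  \row_j (if j == i then t else x ord0 j).

Lemma integrable_consrV n (g : 'rV[R]_n.+1 -> \bar R) :
  (leb n.+1).-integrable setT g ->
  (mu1 \x leb n)%E.-integrable setT (g \o @consrV R n).
Proof.
move=> /integrableP[mg ig]; apply/integrableP; split.
  exact: measurableT_comp mg (@measurable_consrV R n).
move: ig; rewrite (ge0_integral_pushforward (@measurable_consrV R n))//.
exact: measurableT_comp.
Qed.

Lemma integral_consrV n (g : 'rV[R]_n.+1 -> \bar R) :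
  (leb n.+1).-integrable setT g ->
  (\int[leb n.+1]_x g x = \int[mu1 \x leb n]_p g (consrV p))%E.
Proof.
move=> ig; have /integrableP[mg _] := ig.
rewrite (integral_pushforward (@measurable_consrV R n) mg)//.
exact: integrable_consrV.
Qed.

(** The hyperplane is a box with one side [[set 0]], whose zero length annihilates the product. *)
Lemma negligible_coord_rV n (j : 'I_n) :
  leb n [set x | x ord0 j = 0] = 0%E.
Proof.
pose A i : set (measurableTypeR R) := if i == j then [set 0] else setT.
transitivity (leb n [set x | forall i, A i (x ord0 i)]); last first.
  rewrite lebesgue_rV_box; last by move=> i; rewrite /A; case: ifP.
  by rewrite (bigD1 j)//= {1}/A eqxx lebesgue_measure_set1 mul0e.
congr (leb n _); apply/seteqP; split => x /= => [xj i|/(_ j)];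
  last by rewrite /A eqxx.
by rewrite /A; case: eqP => // ->.
Qed.

Lemma ae_coord_neq0_rV n : {ae leb n, forall x : 'rV[R]_n, forall j,
  x ord0 j != 0}.
Proof.
have subN : ~` [set x : 'rV[R]_n | forall j, x ord0 j != 0] `<=`
    \big[setU/set0]_(j < n) [set x | x ord0 j = 0].
  move=> x /=; rewrite -existsNE => -[j /negP/negPn/eqP xj].
  by rewrite -bigcup_seq; exists j => //=; rewrite mem_index_enum.
apply: negligibleS subN _.
elim/big_ind : _ => [|A B|j _]; [exact: negligible_set0|exact: negligibleU|].
apply/negligibleP; last exact: negligible_coord_rV.
rewrite -[X in measurable X]setTI.
exact: (@measurable_coord_rV R n j measurableT [set 0] (measurable_set1 0)).
Qed.

(** Lines having a zero among their other coordinates form a null set, so nothing is asked of them;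
    lines through the origin can thus be ignored. Fubini and induction on [n] peel off the first
    coordinate. *)
Lemma integral_lines_eq0 n (i : 'I_n) (g : 'rV[R]_n -> R) :
  (leb n).-integrable setT (EFin \o g) ->
  (forall x : 'rV[R]_n, (forall j, j != i -> x ord0 j != 0) ->
    (\int[mu1]_t (g (update_rV x i t))%:E = 0)%E) ->
  (\int[leb n]_x (g x)%:E = 0)%E.
Proof.
elim: n i g => [[]//|n IHn] i g ig line0.
have ig' := integrable_consrV ig.
rewrite integral_consrV//.
(* If [i] is not the first coordinate, the latter is the outer variable and the induction hypothesis
   applies to almost every slice, [t = 0] being discarded. Otherwise it is the inner variable and
   the hypothesis on lines applies directly. *)
case: (unliftP ord0 i) => [j|] iE.
  rewrite -(integral12_prod_meas1 ig').
  transitivity (\int[mu1]_x cst 0%E x)%E; last by rewrite integral0.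
  apply: ae_eq_integral => //; first exact: (measurable_fubini_F ig').
  have t0 : {ae mu1, forall t : R, t != 0}.
    exists [set 0]; split => //; first exact: lebesgue_measure_set1.
    by move=> t /= /negP/negPn/eqP.
  near=> t => _; apply: IHn (j) _ _ _.
    by near: t; exact: ae_integrable1 ig'.
  move=> x x0; rewrite -(line0 (consrV (t, x))).
    apply: eq_integral => s _; congr (g _)%:E; rewrite iE.
    apply/rowP => l; rewrite !mxE; case: (unliftP ord0 l) => [m|] ->.
      by rewrite (inj_eq lift_inj) /= mxE.
    by rewrite (negbTE (neq_lift _ _)).
  move=> l; rewrite iE mxE; case: (unliftP ord0 l) => [m|] -> /=.
    by rewrite (inj_eq lift_inj) => /x0.
  by move=> _; near: t.
rewrite -(integral21_prod_meas1 ig').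
transitivity (\int[leb n]_x cst 0%E x)%E; last by rewrite integral0.
apply: ae_eq_integral => //; first exact: (measurable_fubini_G ig').
(* The entry 0 is a placeholder: [update_rV] overwrites it with the integration variable. *)
near=> x => _; rewrite /cst -(line0 (consrV (0, x))).
  apply: eq_integral => s _; congr (g _)%:E; rewrite iE.
  apply/rowP => l; rewrite !mxE; case: (unliftP ord0 l) => [m|] -> //=.
move=> l; rewrite iE mxE; case: (unliftP ord0 l) => [m|] -> /=;
  last by rewrite eqxx.
move=> _; move: m; near: x; exact: ae_coord_neq0_rV.
Unshelve. all: end_near. Qed.

End fubini_rV.

Section euclidean_theory.
Context {R : realType} {n : nat}.
Implicit Types (x y v : 'rV[R]_n) (i : 'I_n).

Lemma dotrV_ge0 x : 0 <= dotrV x x.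
Proof. by apply: sumr_ge0 => i _; rewrite -expr2 sqr_ge0. Qed.

Lemma dotrVC x y : dotrV x y = dotrV y x.
Proof. by apply: eq_bigr => i _; rewrite mulrC. Qed.

Lemma coord_sqr_le_dotrV x i : x ord0 i ^+ 2 <= dotrV x x.
Proof.
rewrite /dotrV (bigD1 i)//= -expr2 lerDl sumr_ge0// => j _.
by rewrite -expr2 sqr_ge0.
Qed.

Lemma dotrV_eq0 x : (dotrV x x == 0) = (x == 0).
Proof.
apply/idP/eqP => [/eqP x0|->]; last first.
  by rewrite /dotrV big1// => i _; rewrite mxE mul0r.
apply/rowP => i; apply/eqP; rewrite mxE -sqrf_eq0 eq_le sqr_ge0 andbT.
by rewrite -x0 coord_sqr_le_dotrV.
Qed.

Lemma dotrV_gt0 x : (0 < dotrV x x) = (x != 0).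
Proof. by rewrite lt_def dotrV_eq0 dotrV_ge0 andbT. Qed.

Lemma enorm_ge0 x : 0 <= enorm x.
Proof. exact: sqrtr_ge0. Qed.

Lemma sqr_enorm x : enorm x ^+ 2 = dotrV x x.
Proof. by rewrite sqr_sqrtr// dotrV_ge0. Qed.

Lemma enorm_gt0 x : (0 < enorm x) = (x != 0).
Proof. by rewrite sqrtr_gt0 dotrV_gt0. Qed.

Lemma enorm0 : enorm (0 : 'rV[R]_n) = 0.
Proof. by rewrite /enorm (eqP (_ : dotrV 0 0 == 0)) ?sqrtr0// dotrV_eq0. Qed.

Lemma coord_le_enorm x i : `|x ord0 i| <= enorm x.
Proof. by rewrite -sqrtr_sqr ler_wsqrtr// coord_sqr_le_dotrV. Qed.

Lemma enormZ (t : R) x : enorm (t *: x) = `|t| * enorm x.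
Proof.
rewrite /enorm -sqrtr_sqr -sqrtrM ?sqr_ge0//; congr Num.sqrt.
by rewrite /dotrV mulr_sumr; apply: eq_bigr => i _; rewrite !mxE; ring.
Qed.

Lemma continuous_coord_rV i : continuous (fun x : 'rV[R]_n => x ord0 i).
Proof. by move=> x; exact: coord_continuous. Qed.

Lemma continuous_dotrV : continuous (fun x : 'rV[R]_n => dotrV x x).
Proof.
apply: continuous_big => [|i _]; first exact: add_continuous.
by move=> x; apply: continuousM; exact: continuous_coord_rV.
Qed.

Lemma continuous_enorm : continuous (@enorm R n).
Proof.
move=> x; apply: continuous_comp; first exact: continuous_dotrV.
exact: sqrt_continuous.
Qed.

Lemma open_unit_ball : open (@unit_ball R n).
Proof.
rewrite (_ : unit_ball = @enorm R n @^-1` [set t | t < 1]) //.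
apply: open_comp; last exact: open_lt.
by move=> x _; exact: continuous_enorm.
Qed.

Lemma measurable_unit_ball : measurable (@unit_ball R n).
Proof. by apply: open_measurable_rV; exact: open_unit_ball. Qed.

End euclidean_theory.

(** * Integrability of the inverse square of the norm *)

Section inverse_square.
Context {R : realType} {n : nat}.
Local Notation leb := (@lebesgue_rV R n).

Let cube (k : nat) : set 'rV[R]_n :=
  [set x | forall i, `[- 2 ^- k, 2 ^- k]%classic (x ord0 i)].

Let measurable_cube k : measurable (cube k).
Proof. by apply: (@measurable_box R n (fun=> `[- 2 ^- k, 2 ^- k]%classic)). Qed.

Let lebesgue_cube k : leb (cube k) = ((2 / 2 ^+ k) ^+ n)%:E.
Proof.
have k0 : (0 : R) < 2 ^- k by rewrite invr_gt0 exprn_gt0.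
rewrite (@lebesgue_rV_box R n (fun=> `[- 2 ^- k, 2 ^- k]%classic))//.
rewrite (eq_bigr (fun=> (2 / 2 ^+ k)%:E)) => [|i _].
  by rewrite prodEFin prodr_const card_ord.
rewrite lebesgue_measure_itv/= lte_fin ifT; last by lra.
by rewrite -EFinB; congr EFin; ring.
Qed.

Let dyadic_scale (r : R) : 0 < r < 1 ->
  exists k : nat, 2 ^- k.+1 < r <= 2 ^- k.
Proof.
move=> /andP[r0 r1].
have ex : exists k : nat, 2 ^- k < r.
  have [k] := ltr_add_invr r0; rewrite add0r => kr; exists k.+1.
  apply: le_lt_trans kr; rewrite lef_pV2 ?posrE ?exprn_gt0//.
  by rewrite -natrX ler_nat ltnW// ltn_expl.
case: (ex_minnP ex) => -[|k]; first by rewrite expr0 invr1 => ?; lra.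
move=> kr kmin; exists k; rewrite kr/= leNgt; apply/negP => /kmin.
by rewrite ltnn.
Qed.

(* Dyadic decomposition: [|x|^-2 <= \sum_k 4^(k+1) 1_(cube k) x], and the series
   of integrals is geometric of ratio [4 / 2^n <= 1/2]. *)
Lemma integrable_inverse_square (f : 'rV[R]_n -> R) (M : R) : (3 <= n)%N ->
  measurable_fun setT f ->
  (forall x, unit_ball x -> `|f x| <= M / dotrV x x) ->
  leb.-integrable unit_ball (EFin \o f).
Proof.
move=> n3 mf fM.
wlog M0 : M fM / 0 <= M.
  move=> wlog; apply: (wlog `|M|) => // x /fM /le_trans; apply.
  by rewrite ler_wpM2r ?invr_ge0 ?dotrV_ge0// ler_norm.
pose h (k : nat) (x : 'rV[R]_n) : \bar R :=
  ((M * 4 ^+ k.+1)%:E * (\1_(cube k) x)%:E)%E.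
have h0 k x : (0 <= h k x)%E.
  by rewrite mule_ge0// lee_fin mulr_ge0// exprn_ge0.
have mh k : measurable_fun setT (h k).
  by apply: measurable_funeM; apply/measurable_EFinP; exact: measurable_indic.
have mH : measurable_fun setT (fun x => \sum_(k <oo) h k x)%E.
  exact: (@ge0_emeasurable_sum _ _ _ setT h xpredT (fun k x _ _ => h0 k x)
    (fun k _ => mh k)).
have H0 x : (0 <= \sum_(k <oo) h k x)%E by apply: nneseries_ge0.
apply: (@le_integrable _ _ _ _ _ measurable_unit_ball _
    (fun x => \sum_(k <oo) h k x)%E); last first.
- apply: (integrableS _ measurable_unit_ball (subsetT _)) => //.
  apply/integrableP; split => //.
  under eq_integral do rewrite gee0_abs//.
  rewrite integral_nneseries//.
  have intE k : (\int[leb]_x h k x = (M * 4 * 2 ^+ n * (4 / 2 ^+ n) ^+ k)%:E)%E.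
    rewrite ge0_integralZl//; last 2 first.
    - by apply/measurable_EFinP; exact: measurable_indic.
    - by rewrite lee_fin mulr_ge0// exprn_ge0.
   
    rewrite integral_indic// setIT.
    transitivity ((M * 4 ^+ k.+1)%:E * ((2 / 2 ^+ k) ^+ n)%:E)%E.
      by congr (_ * _)%E; exact: lebesgue_cube.
    rewrite -EFinM; congr EFin.
    rewrite exprS !exprMn -!exprVn -!exprM (mulnC k n).
    by rewrite mulrA; ring.
  (* For [n >= 3], [(4 / 2^n)^k <= 2^-k = 2 / 2^(k+1)], so the series is at most twice its constant
     factor. *)
  apply: (@le_lt_trans _ _ ((M * 4 * 2 ^+ n * 2)%:E)); last exact: ltry.
  apply: le_trans (epsilon_trick0 xpredT _); last first.
    by rewrite !mulr_ge0// exprn_ge0.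
  apply: lee_nneseries => [k _ _|k _]; first exact: integral_ge0.
  rewrite intE lee_fin -!mulrA !ler_wpM2l ?exprn_ge0//.
  rewrite natrX exprS invfM mulrA divff// mul1r -[leRHS]exprVn.
  apply: lerXn2r; rewrite ?nnegrE ?divr_ge0 ?exprn_ge0// ?invr_ge0//.
  rewrite ler_pdivrMr ?exprn_gt0// -(subnK n3) exprD.
  have : (1 : R) <= 2 ^+ (n - 3) by rewrite exprn_ege1// ler1n.
  by lra.
- move=> x Bx /=; rewrite [leRHS]gee0_abs//.
  (* At the origin [M / 0 = 0], so the hypothesis forces [f 0 = 0]. *)
  have [x0|x0] := eqVneq x 0.
    apply: le_trans (H0 x); rewrite lee_fin; apply: le_trans (fM x Bx) _.
    by rewrite (eqP (_ : dotrV x x == 0)) ?dotrV_eq0 ?x0// invr0 mulr0.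
  have /dyadic_scale[k /andP[kx xk]] : 0 < enorm x < 1 by rewrite enorm_gt0 x0.
  (* The single term of index [k] suffices: [|x| <= 2^-k] puts [x] in [cube k], and [2^-(k+1) < |x|]
     gives [|x|^-2 <= 4^(k+1)]. *)
  apply: le_trans (nneseries_lim_ge k.+1 _) => //.
  rewrite big_nat_recr//= -[leLHS]add0e leeD ?sume_ge0//.
  rewrite /h indicE mem_set ?mule1 ?lee_fin; last first.
    move=> i; rewrite /= in_itv/= -ler_norml.
    exact: le_trans (coord_le_enorm x i) xk.
  apply: le_trans (fM x Bx) _; rewrite ler_wpM2l// -sqr_enorm.
  rewrite -[leRHS]invrK lef_pV2 ?posrE ?invr_gt0 ?exprn_gt0 ?enorm_gt0//.
  rewrite (_ : 4 = 2 ^+ 2); last by ring.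
  by rewrite -exprM mulnC exprM -exprVn lerXn2r ?nnegrE ?invr_ge0 ?exprn_ge0
    ?enorm_ge0 ?ltW.
- by apply/measurable_EFinP; exact: measurable_funTS.
Qed.

End inverse_square.

(** * Integration by parts on the unit ball *)

Section test_function_theory.
Context {R : realType} {n : nat}.
Variables (Omega : set 'rV[R]_n) (phi : 'rV[R]_n -> R).
Hypothesis tphi : test_function Omega phi.
Local Notation supp := (closure [set x | phi x != 0]).

Lemma test_function_is_derive i x :
  is_derive x (delta_mx ord0 i) phi (partial i phi x).
Proof.
case: tphi => sphi _ _; apply: DeriveDef => //.
by apply: diff_derivable; exact: (sphi [::]).
Qed.

Lemma test_function_continuous : continuous phi.
Proof.
by case: tphi => sphi _ _ x; apply: differentiable_continuous;
  exact: (sphi [::]).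
Qed.

Lemma partial_test_function_continuous i : continuous (partial i phi).
Proof.
case: tphi => sphi _ _ x; apply: differentiable_continuous.
exact: (sphi [:: i]).
Qed.

Lemma test_function_out x : ~ supp x -> phi x = 0.
Proof.
by move=> xS; apply/eqP/negPn/negP => x0; apply: xS; exact: subset_closure.
Qed.

Lemma partial_test_function_out i x : ~ supp x -> partial i phi x = 0.
Proof.
move=> xS; rewrite /partial (@near_eq_derive _ _ _ _ (cst 0)).
  by rewrite derive_cst.
have : open (~` supp) by apply: closed_openC; exact: closed_closure.
rewrite openE => /(_ x xS); apply: filterS => y; exact: test_function_out.
Qed.

Lemma test_function_supp : supp `<=` Omega.
Proof. by case: tphi. Qed.

Lemma bounded_compact_support (g : 'rV[R]_n -> R) :
  continuous g -> (forall x, ~ supp x -> g x = 0) ->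
  exists2 M, 0 <= M & forall x, `|g x| <= M.
Proof.
case: tphi => _ cS _ cg g0.
have /compact_bounded[M [_ /(_ (`|M| + 1))gM]] : compact (g @` supp).
  by apply: continuous_compact => //; exact: continuous_subspaceT.
exists (`|M| + 1) => [|x]; first by rewrite addr_ge0.
have [xS|/g0 ->] := pselect (supp x); last by rewrite normr0 addr_ge0.
by apply: gM; [rewrite (le_lt_trans (ler_norm _))// ltrDl|exists x].
Qed.

End test_function_theory.

Section lines.
Context {R : realType} {n : nat}.
Implicit Types (x : 'rV[R]_n) (i : 'I_n).

Lemma update_rVE x i (t : R) :
  update_rV x i t = t *: delta_mx ord0 i + update_rV x i 0.
Proof.
by apply/rowP => j; rewrite !mxE eqxx/=; case: eqVneq => _; rewrite /=; ring.
Qed.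

Lemma continuous_update_rV x i : continuous (update_rV x i).
Proof.
rewrite (_ : update_rV x i =
    fun t => t *: delta_mx ord0 i + update_rV x i 0) => [t|]; last first.
  by apply/funext => t; exact: update_rVE.
by apply: cvgD; [exact: scalel_continuous|exact: cvg_cst].
Qed.

(** Moving along the i-th axis and moving the parameter [t] give the same difference quotient, so
    one-variable calculus applies on each line. *)
Lemma is_derive_update_rV x i (f : 'rV[R]_n -> R) (t l : R) :
  is_derive (update_rV x i t) (delta_mx ord0 i) f l ->
  is_derive t 1 (f \o update_rV x i) l.
Proof.
have E : (fun h : R => h^-1 *: ((f \o shift (update_rV x i t))
      (h *: delta_mx ord0 i) - f (update_rV x i t))) =
    (fun h : R => h^-1 *: (((f \o update_rV x i) \o shift t) (h *: 1) -
      (f \o update_rV x i) t)).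
  apply/funext => h /=; congr (_ *: (f _ - _)).
  by rewrite !(update_rVE _ _ (_ + _)) update_rVE scalerDl addrA [h *: 1]mulr1.
move=> [df <-]; apply: DeriveDef; first by move: df; rewrite /derivable E.
by rewrite /derive E.
Qed.

End lines.

(** The fundamental theorem of calculus on [[-1, 1]]: [w] vanishes at both ends, and [dw] vanishes
    outside. *)
Lemma integral_derive_compact_support {R : realType} (w dw : R -> R) :
  (forall t : R, is_derive t 1 w (dw t)) -> continuous dw ->
  (forall t : R, 1 <= `|t| -> w t = 0) -> (forall t : R, 1 <= `|t| ->
    dw t = 0) ->
  (\int[lebesgue_measure]_t (dw t)%:E = 0)%E.
Proof.
move=> wdw cdw w0 dw0.
have cw t : {for t, continuous w}.
  by apply/differentiable_continuous/derivable1_diffP; case: (wdw t).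
transitivity (\int[lebesgue_measure]_(t in `[(-1)%R, 1%R]) (dw t)%:E)%E.
  rewrite [RHS]integral_mkcond; apply: eq_integral => t _; rewrite patchE.
  case: ifPn => //; rewrite notin_setE/= in_itv/= -ler_norml => /negP.
  by rewrite -ltNge => /ltW /dw0 ->.
rewrite (@continuous_FTC2 _ _ w); first by rewrite !w0 ?normrN1 ?normr1// subee.
- by rewrite -subr_gt0 opprK addr_gt0.
- exact: continuous_subspaceT.
- split; first by move=> t _; case: (wdw t).
    exact/cvg_at_right_filter/cw.
  exact/cvg_at_left_filter/cw.
- by move=> t _; rewrite derive1E; case: (wdw t).
Qed.

Section integration_by_parts.
Context {R : realType} {n : nat}.
Local Notation leb := (@lebesgue_rV R n).
Local Notation B := (@unit_ball R n).

(* Almost every line parallel to the i-th axis misses the singularity at 0. *)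
Lemma integration_by_parts_ball (i : 'I_n) (f df phi : 'rV[R]_n ->
  R) (M N : R) :
  (3 <= n)%N ->
  (forall x : 'rV[R]_n, x != 0 -> {for x, continuous f}) ->
  (forall x : 'rV[R]_n, x != 0 -> {for x, continuous df}) ->
  (forall x : 'rV[R]_n, x != 0 -> is_derive x (delta_mx ord0 i) f (df x)) ->
  (forall x, B x -> `|f x| <= M / dotrV x x) ->
  (forall x, B x -> `|df x| <= N / dotrV x x) ->
  test_function B phi ->
  [/\ leb.-integrable B (fun x => (f x * partial i phi x)%:E),
      leb.-integrable B (fun x => (df x * phi x)%:E) &
  (\int[leb]_(x in B) (f x * partial i phi x)%:E =
     - \int[leb]_(x in B) (df x * phi x)%:E)%E].
Proof.
move=> n3 cf cdf fdf fM dfM tphi.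
have cphi := test_function_continuous tphi.
have cdphi := @partial_test_function_continuous _ _ _ _ tphi i.
have mB := @measurable_unit_ball R n.
have phi0 x : ~ B x -> phi x = 0.
  by move=> Bx; apply: test_function_out => /(test_function_supp tphi).
have dphi0 x : ~ B x -> partial i phi x = 0.
  move=> Bx; apply: partial_test_function_out.
  by move=> /(test_function_supp tphi).
have int_prod (g psi : 'rV[R]_n -> R) L :
    (forall x : 'rV[R]_n, x != 0 -> {for x, continuous g}) -> continuous psi ->
    (forall x, B x -> `|g x| <= L / dotrV x x) ->
    (forall x, ~ closure [set x | phi x != 0] x -> psi x = 0) ->
    leb.-integrable B (fun x => (g x * psi x)%:E).
  move=> cg cpsi gM psi0.
  have [N' N0 psiN] := bounded_compact_support tphi cpsi psi0.
  apply: (@integrable_inverse_square _ _ (fun x => g x * psi x) (L * N')) => //.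
    apply: measurable_funM; first exact: measurable_fun_continuous_off0.
    exact: continuous_measurable_rV.
  move=> x Bx; rewrite normrM mulrAC ler_pM//.
  exact: gM.
have i1 := int_prod f (partial i phi) M cf cdphi fM
  (@partial_test_function_out _ _ phi i).
have i2 := int_prod df phi N cdf cphi dfM (@test_function_out _ _ phi).
split=> //.
(* Both integrals are finite, so the identity amounts to the vanishing of their sum, the integral of
   the i-th derivative of [f * phi]. *)
suff : (\int[leb]_(x in B) (f x * partial i phi x)%:E +
        \int[leb]_(x in B) (df x * phi x)%:E = 0)%E.
  have := integrable_fin_num mB i2; have := integrable_fin_num mB i1.
  move: (\int[leb]_(x in B) _)%E (\int[leb]_(x in B) _)%E => [a||] [b||]// _ _.
  by move=> [/eqP]; rewrite addr_eq0 => /eqP ->.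
rewrite -integralD//; pose dw x := f x * partial i phi x + df x * phi x.
have out x : ~ B x -> dw x = 0 by move=> Bx;
  rewrite /dw phi0 ?dphi0// !mulr0 addr0.
(* Since [dw] vanishes off the ball, the integral extends to the whole space, where Fubini is
   available on complete lines. *)
have dwE : (fun x => (dw x)%:E) = ((fun x => (dw x)%:E) \_ B).
  apply/funext => x; rewrite patchE; case: ifPn => //.
  by rewrite notin_setE => /out ->.
transitivity (\int[leb]_x (dw x)%:E)%E.
  by rewrite [in RHS]dwE -[RHS]integral_mkcond; exact: eq_integral.
apply: (integral_lines_eq0 (i := i)).
  rewrite (_ : EFin \o dw = (fun x => (dw x)%:E) \_ B)//.
  by rewrite -integrable_mkcond//; exact: (integrableD mB i1 i2).
move=> x x0; set y := update_rV x i.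
(* As [n >= 3] there is an index [j != i], and [x_j != 0] keeps the whole line away from the
   origin. *)
have y0 t : y t != 0.
  have [j ji] : exists j : 'I_n, j != i.
    have n1 : (1 < n)%N by exact: leq_trans n3.
    have n0 : (0 < n)%N by exact: leq_trans n3.
    have [i0|i0] := eqVneq i (Ordinal n0); first by exists (Ordinal n1);
      rewrite i0.
    by exists (Ordinal n0); rewrite eq_sym.
  apply: contra_neq (x0 j ji) => /rowP/(_ j).
  by rewrite !mxE (negbTE ji).
have yB t : 1 <= `|t| -> ~ B (y t).
  move=> t1; apply/negP; rewrite -leNgt; apply: le_trans t1 _.
  by apply: le_trans (coord_le_enorm (y t) i); rewrite mxE eqxx.
have cy := @continuous_update_rV _ _ x i.
apply: (@integral_derive_compact_support _ ((f \o y) *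
  (phi \o y))) => [t|t|t|t].
- rewrite /dw (_ : _ + _ =
    (f \o y) t *: partial i phi (y t) + (phi \o y) t *: df (y t)); last first.
    by rewrite /= ![_ *: _]mulrC mulrC.
  apply: is_deriveM; apply: is_derive_update_rV; first exact: fdf.
  exact: (test_function_is_derive tphi).
- apply: (continuousD (f := fun t => f (y t) * partial i phi (y t))
    (g := fun t => df (y t) * phi (y t))); apply: continuousM.
  + by apply: continuous_comp; [exact: cy|exact: cf].
  + by apply: continuous_comp; [exact: cy|exact: cdphi].
  + by apply: continuous_comp; [exact: cy|exact: cdf].
  + by apply: continuous_comp; [exact: cy|exact: cphi].
- by move=> /yB ?; rewrite /= fctE/= phi0// mulr0.
- by move=> /yB /out.
Qed.

End integration_by_parts.

(** * Coefficient matrices *)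

Section coefficient_matrix.
Context {R : realType} {n : nat}.
Implicit Types p F v w : 'rV[R]_n.

Lemma dotrVDl u v w : dotrV (u + v) w = dotrV u w + dotrV v w :> R.
Proof.
by rewrite -big_split; apply: eq_bigr => i _; rewrite mxE mulrDl.
Qed.

Lemma dotrVZl c v w : dotrV (c *: v) w = c * dotrV v w :> R.
Proof. by rewrite mulr_sumr; apply: eq_bigr => i _; rewrite mxE mulrA. Qed.

Lemma cauchy_schwarz_dotrV v w : dotrV v w ^+ 2 <= dotrV v v * dotrV w w.
Proof.
have [->|w0] := eqVneq w 0.
  by rewrite dotrVC -[0](scale0r 0) !dotrVZl !mul0r mulr0 expr0n.
rewrite -subr_ge0 -(pmulr_rge0 _ (_ : 0 < dotrV w w)) ?dotrV_gt0//.
have := dotrV_ge0 (dotrV w w *: v + - dotrV v w *: w).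
rewrite dotrVDl !dotrVZl !(dotrVC _ (_ + _)) !dotrVDl !dotrVZl (dotrVC w v).
by move=> /le_trans; apply; rewrite le_eqVlt; apply/orP; left; apply/eqP; ring.
Qed.

(** The first term is a rank-one form sending [p] to [F]; the second is [K] times the orthogonal
    projection off [p], which kills [p] and restores positivity in the other directions. When
    [p = F = 0], division by zero gives 0 and the matrix is [K] times the identity. *)
Definition two_vector_mx (K : R) p F : 'M[R]_n :=
  \matrix_(i, j) (F ord0 i * F ord0 j / dotrV F p +
    K * ((i == j)%:R - p ord0 i * p ord0 j / dotrV p p)).

Lemma two_vector_mxE K p F v :
  mulmxrV (two_vector_mx K p F) v = (dotrV F v / dotrV F p) *: F +
    K *: (v - (dotrV p v / dotrV p p) *: p).
Proof.
apply/rowP => i; rewrite !mxE.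
have -> : v ord0 i = \sum_j (i == j)%:R * v ord0 j.
  rewrite (bigD1 i)//= eqxx mul1r big1 ?addr0// => j.
  by rewrite eq_sym => /negbTE ->; rewrite mul0r.
rewrite /dotrV [_ / _ * F _ _]mulrAC [_ / _ * p _ _]mulrAC !mulr_suml.
rewrite -sumrB mulr_sumr -big_split; apply: eq_bigr => j _ /=.
by rewrite !mxE; ring.
Qed.

Lemma trmx_two_vector_mx K p F : (two_vector_mx K p F)^T = two_vector_mx K p F.
Proof.
apply/matrixP => i j; rewrite !mxE eq_sym (mulrC (F _ j)) (mulrC (p _ j)) //.
Qed.

Let flux_eq0 K p F : dotrV F F + dotrV p p <= K * dotrV F p -> p = 0 -> F = 0.
Proof.
move=> pF p0; apply/eqP; rewrite -dotrV_eq0 eq_le dotrV_ge0 andbT.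
have : dotrV F p = 0 by rewrite p0 dotrVC -[0](scale0r 0) dotrVZl mul0r.
by move=> Fp; have := pF; rewrite Fp mulr0 => ?; have := dotrV_ge0 p; lra.
Qed.

Let dot_gt0 K p F : 1 <= K -> dotrV F F + dotrV p p <= K * dotrV F p ->
  p != 0 -> 0 < dotrV F p.
Proof.
move=> K1 pF; have K0 : 0 < K by exact: lt_le_trans ltr01 K1.
rewrite -dotrV_gt0 => p0; rewrite -(pmulr_rgt0 _ K0).
by have := dotrV_ge0 F; lra.
Qed.

Lemma two_vector_mx_flux K p F : 1 <= K ->
  dotrV F F + dotrV p p <= K * dotrV F p ->
  mulmxrV (two_vector_mx K p F) p = F.
Proof.
move=> K1 pF; rewrite two_vector_mxE; have [p0|p0] := eqVneq p 0.
  by rewrite (flux_eq0 pF p0) p0 !scaler0 subr0 scaler0 addr0.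
by rewrite !divff ?dotrV_eq0 ?gt_eqF ?(dot_gt0 K1 pF)// !scale1r subrr scaler0
  addr0.
Qed.

(* With [v' = v - (p.v/p.p) p], splitting [F.v = (p.v)(F.p)/(p.p) + F.v'] bounds
   the component of [v] along [p] by [F.v] and [|v'|]. *)
Lemma two_vector_mx_elliptic K p F v : 1 <= K ->
  dotrV F F + dotrV p p <= K * dotrV F p ->
   (3 * K)^-1 * enorm v ^+ 2 <= dotrV (mulmxrV (two_vector_mx K p F) v) v
    <= (3 * K) * enorm v ^+ 2.
Proof.
move=> K1 pF; rewrite two_vector_mxE sqr_enorm ler_pdivrMl; last by lra.
have X0 := dotrV_ge0 v; have [p0|p0] := eqVneq p 0.
  rewrite (flux_eq0 pF p0) p0 !scaler0 subr0 add0r dotrVZl.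
  have KX : dotrV v v <= K * dotrV v v by rewrite ler_peMl.
  have KKX : K * dotrV v v <= K * (K * dotrV v v) by rewrite ler_wpM2l//; lra.
  by rewrite -!mulrA; apply/andP; split; lra.
have s0 := dot_gt0 K1 pF p0; have q0 : 0 < dotrV p p by rewrite dotrV_gt0.
have f0 := dotrV_ge0 F.
set s := dotrV F p in pF s0 *; set q := dotrV p p in pF q0 *.
set f := dotrV F F in pF f0 *; set X := dotrV v v in X0 *.
pose v' := v + - (dotrV p v / q) *: p.
have Y0 : 0 <= X - dotrV p v ^+ 2 / q.
  rewrite subr_ge0 ler_pdivrMr// mulrC; exact: cauchy_schwarz_dotrV.
have v'E : dotrV v' v' = X - dotrV p v ^+ 2 / q.
  rewrite !dotrVDl !dotrVZl !(dotrVC _ (_ + _)) !dotrVDl !dotrVZl.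
  rewrite (dotrVC v p) -/X -/q; field; exact: lt0r_neq0.
have Fv'E : dotrV F v' = dotrV F v - dotrV p v * s / q.
  by rewrite dotrVC dotrVDl dotrVZl (dotrVC p F) (dotrVC v F) -/s; ring.
have cs := cauchy_schwarz_dotrV F v'; rewrite v'E Fv'E in cs.
have cs2 := cauchy_schwarz_dotrV F v.
rewrite dotrVDl !dotrVZl -scaleNr -/v' dotrVDl dotrVZl -/X.
set a := dotrV F v in cs cs2 *; set b := dotrV p v in Y0 cs *.
rewrite -/f -/X in cs cs2.
set Y := X - b ^+ 2 / q in Y0 cs.
have -> : X + - (b / q) * b = Y by rewrite /Y; field; exact: lt0r_neq0.
(* By Cauchy-Schwarz [(F.v)^2 <= |F|^2 |v|^2], and [|F|^2 <= K F.p]; this is the upper bound for the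
   rank-one part. *)
have a2 : a / s * a <= K * X.
  rewrite mulrAC ler_pdivrMr// -expr2; apply: le_trans cs2 _.
  by rewrite [leRHS]mulrAC ler_wpM2r//; lra.
have YX : Y <= X by rewrite gerBl divr_ge0 ?sqr_ge0// ltW.
apply/andP; split; last by nra.
have bq : b ^+ 2 / q <= 2 * K * (a / s * a) + 2 * K ^+ 2 * Y.
  (* With [c = b s / q], Cauchy-Schwarz for [F.v' = a - c] reads [(a - c)^2 <= f Y], and [2 a^2 + 2
     (a - c)^2 - c^2 = (2 a - c)^2 >= 0]. *)
  have e1 : (b * s / q) ^+ 2 <= 2 * a ^+ 2 + 2 * f * Y.
    have := sqr_ge0 (2 * a - b * s / q); move: cs; set c := b * s / q; nra.
  have -> : b ^+ 2 / q = (b * s / q) ^+ 2 * (q / s ^+ 2).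
    by field; rewrite !lt0r_neq0.
  apply: le_trans (ler_wpM2r _ e1) _; first by rewrite divr_ge0 ?sqr_ge0// ltW.
  rewrite mulrA ler_pdivrMr ?exprn_gt0//.
  have -> : (2 * K * (a / s * a) + 2 * K ^+ 2 * Y) * s ^+ 2 =
      2 * a ^+ 2 * (K * s) + 2 * Y * (K * s) ^+ 2 by field; rewrite lt0r_neq0.
  have qs : q <= K * s by lra.
  have fs : f <= K * s by lra.
  rewrite mulrDl; apply: lerD.
    by rewrite ler_wpM2l// mulr_ge0// sqr_ge0.
  rewrite (_ : 2 * f * Y * q = 2 * Y * (f * q)); last by ring.
  by rewrite ler_wpM2l ?mulr_ge0// expr2 ler_pM// ltW.
(* Altogether [X <= (1 + 2 K^2) Y + 2 K a^2 / s <= 3 K (a^2 / s + K Y)], which is the lower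
   bound. *)
have XE : X = Y + b ^+ 2 / q by rewrite /Y; ring.
have ge1 : Y <= K ^+ 2 * Y by rewrite ler_peMl// expr_ge1//; lra.
have as0 : 0 <= a / s * a by rewrite mulrAC -expr2 divr_ge0 ?sqr_ge0// ltW.
have : 2 * K * (a / s * a) <= 3 * K * (a / s * a) by rewrite ler_wpM2r//; lra.
rewrite mulrDr (_ : 3 * K * (K * Y) = 3 * (K ^+ 2 * Y)); last by ring.
by move: bq; rewrite -mulrA; lra.
Qed.

(** The rank-one entries are at most [|F|^2 / F.p <= K]; the projection term contributes at most
    [K (1 + 1)]. *)
Lemma two_vector_mx_bounded K p F i j : 1 <= K ->
  dotrV F F + dotrV p p <= K * dotrV F p ->
  `|two_vector_mx K p F i j| <= 3 * K.
Proof.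
move=> K1 pF.
have ab (v : 'rV[R]_n) : `|v ord0 i * v ord0 j| <= dotrV v v.
  rewrite normrM -sqr_enorm expr2.
  by apply: ler_pM => //; exact: coord_le_enorm.
rewrite mxE; apply: le_trans (ler_normD _ _) _.
have -> : 3 * K = K + K * 2 by ring.
have K0 : 0 <= K by lra.
apply: lerD.
  have [p0|p0] := eqVneq p 0;
    first by rewrite (flux_eq0 pF p0) !mxE mul0r mul0r normr0.
  have s0 := dot_gt0 K1 pF p0;
    rewrite normrM normfV (gtr0_norm s0) ler_pdivrMr//.
  by apply: le_trans (ab F) _; have := dotrV_ge0 p; lra.
rewrite normrM (ger0_norm K0) ler_wpM2l//.
apply: le_trans (ler_normB _ _) _; rewrite -[leRHS]/(1 + 1); apply: lerD.
  by rewrite normr_nat; case: eqP.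
have [p0|p0] := eqVneq p 0; first by rewrite p0 !mxE mul0r mul0r normr0.
have q0 : 0 < dotrV p p by rewrite dotrV_gt0.
by rewrite normrM normfV (gtr0_norm q0) ler_pdivrMr// mul1r.
Qed.

End coefficient_matrix.

(** * The angular profile *)

Section profile.
Context {R : realType}.
Implicit Types k t : R.

Definition profile k t : R := (expR (2 * k * t) - 1) / (expR (2 * k * t) + 1).

(* [profile k t = tanh (k t)]; this is its derivative divided by [k]. *)
Definition dprofile k t : R := 1 - profile k t ^+ 2.

Lemma dprofileE k t :
  dprofile k t = 4 * expR (2 * k * t) / (expR (2 * k * t) + 1) ^+ 2.
Proof.
have E0 := expR_gt0 (2 * k * t).
by rewrite /dprofile /profile; field; rewrite lt0r_neq0//; lra.
Qed.

Lemma is_derive_profile k t : is_derive t 1 (profile k) (k * dprofile k t).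
Proof.
have E0 := expR_gt0 (2 * k * t).
have dE : is_derive t 1 (fun s => expR (2 * k * s)) (expR (2 * k * t) *
  (2 * k)).
  apply: (@is_derive1_comp _ expR (fun s => 2 * k * s)).
  rewrite (_ : (fun s => 2 * k * s) = (2 * k) \*: (@id R)) //.
  by apply: is_derive_eq; rewrite ?[_ *: _]mulr1.
have dE1 : is_derive t 1 (fun s => (expR (2 * k * s) + 1)^-1)
    (- (expR (2 * k * t) + 1) ^- 2 *: (expR (2 * k * t) * (2 * k))).
  apply: is_deriveV; first by rewrite lt0r_neq0//; lra.
  by rewrite -[X in is_derive _ _ _ X]addr0; apply: is_deriveD.
have dE2 : is_derive t 1 (fun s => expR (2 * k * s) - 1) (expR (2 * k * t) *
  (2 * k)).
  by rewrite -[X in is_derive _ _ _ X]subr0; apply: is_deriveB.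
rewrite (_ : profile k = (fun s => expR (2 * k * s) - 1) *
  (fun s => (expR (2 * k * s) + 1)^-1)); last by apply/funext.
apply: (is_derive_eq (is_deriveM dE2 dE1)).
rewrite dprofileE /=; set E := expR _ in E0 *.
rewrite /GRing.scale/=; field.
by rewrite lt0r_neq0//; lra.
Qed.

Lemma profileN k t : profile k (- t) = - profile k t.
Proof.
have E0 := expR_gt0 (2 * k * t).
rewrite /profile mulrN expRN; field.
by rewrite !lt0r_neq0//; lra.
Qed.

Lemma dprofileN k t : dprofile k (- t) = dprofile k t.
Proof. by rewrite /dprofile profileN sqrrN. Qed.

(** Both sides come from [1 + y <= exp y]: at [y = 2kt] it gives [E >= 1 + 2t], and at [y = -2kt] it
    gives [E - 1 <= 2kt E], where [E = exp (2kt)]. *)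
Lemma profile_ge_half k t : 1 <= k -> 0 <= t <= 1 ->
  t / 2 <= profile k t <= 2 * k * t.
Proof.
move=> k1 /andP[t0 t1]; have E0 := expR_gt0 (2 * k * t).
have kt0 : 0 <= (k - 1) * t by rewrite mulr_ge0//; lra.
have E1 := expR_ge1Dx (2 * k * t).
have E2 := expR_ge1Dx (- (2 * k * t)).
rewrite expRN in E2; rewrite /profile; set E := expR _ in E0 E1 E2 *.
have EV : E * E^-1 = 1 by rewrite divff// lt0r_neq0.
apply/andP; split.
  rewrite ler_pdivlMr; last by lra.
  have ktE : 2 * t <= E - 1 by lra.
  by nra.
rewrite ler_pdivrMr; last by lra.
have : E * (1 + - (2 * k * t)) <= E * E^-1 by rewrite ler_wpM2l// ltW.
rewrite EV.
have : 0 <= 2 * k * t by rewrite !mulr_ge0//; lra.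
by nra.
Qed.

Lemma dprofile_bounds k t : 0 < dprofile k t <= 1.
Proof.
apply/andP; split; last by rewrite gerBl sqr_ge0.
have E0 := expR_gt0 (2 * k * t).
by rewrite dprofileE divr_gt0 ?exprn_gt0//; lra.
Qed.

(** For [E = exp (2kt) >= 1], [4 E / (E + 1)^2 >= 1 / E >= exp (- 2k)]. This is what makes the
    exponent [exp (- 2k)] small enough to be dominated by the angular derivative. *)
Lemma expR_le_dprofile k t : 0 <= k -> 0 <= t <= 1 ->
  expR (- (2 * k)) <= dprofile k t.
Proof.
move=> k0 /andP[t0 t1].
have E0 := expR_gt0 (2 * k * t).
have E1 : 1 <= expR (2 * k * t) by rewrite -expR0 ler_expR !mulr_ge0.
have F : expR (- (2 * k)) * expR (2 * k * t) <= 1.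
  have kt : 0 <= k * (1 - t) by rewrite mulr_ge0//; lra.
  rewrite -expRD -[leRHS]expR0 ler_expR. lra.
have F0 := expR_gt0 (- (2 * k)).
rewrite dprofileE; set E := expR (2 * k * t) in E0 E1 F *.
rewrite ler_pdivlMr ?exprn_gt0//; last by lra.
have : (E + 1) ^+ 2 <= 4 * E * E by nra.
move=> /(ler_wpM2l (ltW F0)) /le_trans; apply.
rewrite (_ : _ * (4 * E * E) = 4 * E * (expR (- (2 * k)) * E)); last by ring.
by rewrite ler_piMr//; lra.
Qed.

(* Kramers' trade-off: far from [t = 1] the term with [1 - t^2] wins, and at
   distance [O(1/k)] from it [dprofile k t] is comparable to [exp (- 2k)]. *)
Lemma sqr_dprofile_le k t : 1 <= k -> 0 <= t <= 1 ->
  t ^+ 2 * dprofile k t <= 8 * expR (- (2 * k)) * (t * profile k t) +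
    4 * (1 - t ^+ 2) * k * dprofile k t.
Proof.
move=> k1 t01; have /andP[t0 t1] := t01.
have /andP[Gt _] := profile_ge_half k1 t01.
have E0 := expR_gt0 (2 * k * t).
have /andP[b0 b1] := dprofile_bounds k t.
have G1 : profile k t <= 1.
  by rewrite /profile ler_pdivrMr; lra.
set b := dprofile k t in b0 b1 *; set G := profile k t in Gt G1 *.
set a := expR (- (2 * k)).
(* Here [1 - 2k(1 - t) <= exp (2kt) exp (- 2k)], while [b exp (2kt) <= 4]. *)
have aE : b * (1 - 2 * k * (1 - t)) <= 4 * a.
  have := expR_ge1Dx (- (2 * k) + 2 * k * t); rewrite expRD -/a => aE.
  have bE : b * expR (2 * k * t) <= 4.
    rewrite /b dprofileE; set E := expR (2 * k * t) in E0 *.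
    by rewrite mulrAC ler_pdivrMr ?exprn_gt0//; nra.
  apply: (@le_trans _ _ (b * expR (2 * k * t) * a)).
    by rewrite -[leRHS]mulrA ler_pM2l// (mulrC _ a); apply: le_trans aE; lra.
  by rewrite ler_pM2r ?expR_gt0.
have tG : 0 <= t * G by rewrite mulr_ge0//; lra.
have tG1 : t * G <= 1 by nra.
(* The previous bound is weighted by [2 t G >= t^2]. The leftover [4 k b (1 - t) t G] is absorbed by
   [4 k b (1 - t)(1 + t)], since [t G <= 1] and [t >= 0]. *)
have h1 : b * (1 - 2 * k * (1 - t)) * (2 * (t * G)) <= 4 * a * (2 * (t * G)).
  by rewrite ler_wpM2r// mulr_ge0.
have h2 : t ^+ 2 * b <= 2 * (t * G) * b by rewrite ler_pM2r//; nra.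
have kb : 0 <= k * b by rewrite mulr_ge0//; lra.
have h3 : 0 <= k * b * (1 - t) * (1 - t * G) by rewrite !mulr_ge0//; lra.
have h4 : 0 <= k * b * (1 - t) * t by rewrite !mulr_ge0//; lra.
by nra.
Qed.

End profile.

(** * The pointwise inequality between flux and gradient *)

Section flux_profile.
Context {R : realType}.
Implicit Types k t : R.

(* The inner product of [A1 e + B1 d] and [A2 e + B2 d] for unit vectors [e], [d]
   with [e.d = t]. *)
Definition frame_dot t (A1 B1 A2 B2 : R) : R :=
  A1 * A2 + t * (A1 * B2 + B1 * A2) + B1 * B2.

(* The radial coefficient that makes the flux divergence free. *)
Definition flux_profile (n : nat) k t : R :=
  ((1 - expR (- (2 * k))) * (t * dprofile k t) +
    2 * k * (profile k t * dprofile k t) * (1 - t ^+ 2)) /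
  (n%:R - 2 + expR (- (2 * k))).

Lemma flux_profileN n k t : flux_profile n k (- t) = - flux_profile n k t.
Proof. by rewrite /flux_profile profileN dprofileN -[RHS]mulNr; congr (_ / _);
  ring. Qed.

(* The radial coefficient of the gradient of [|x|^alpha profile k t]. *)
Definition grad_profile k t : R :=
  expR (- (2 * k)) * profile k t - t * (k * dprofile k t).

Lemma grad_profileN k t : grad_profile k (- t) = - grad_profile k t.
Proof. by rewrite /grad_profile profileN dprofileN; ring. Qed.

(** Both vectors are split along the radial direction and its orthogonal complement. With
    [X = al b t G] and [Y = (1 - t^2) k b^2], the product [F.Du] is at least [X + Y], and every
    square on the left is at most a multiple of [k (X + Y)]. *)
Let flux_profile_bound_pos (n : nat) k t : (3 <= n)%N -> 1 <= k ->
  0 <= t <= 1 ->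
  frame_dot t (flux_profile n k t) (dprofile k t)
      (flux_profile n k t) (dprofile k t) +
    frame_dot t (grad_profile k t) (k * dprofile k t)
      (grad_profile k t) (k * dprofile k t) <=
  100 * k * frame_dot t (flux_profile n k t) (dprofile k t)
      (grad_profile k t) (k * dprofile k t).
Proof.
move=> n3 k1 t01; set a := flux_profile n k t; set b := dprofile k t.
set A := grad_profile k t; have /andP[t0 t1] := t01.
have al0 := expR_gt0 (- (2 * k)).
have k0 : 0 <= k by lra.
have alb : expR (- (2 * k)) <= b by exact: expR_le_dprofile.
have /andP[b0 b1] : 0 < b <= 1 := dprofile_bounds k t.
have /andP[Gt Gk] := profile_ge_half k1 t01.
have sq := sqr_dprofile_le k1 t01; rewrite -/b in sq.
have n3' : (3 : R) <= n%:R by rewrite ler_nat.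
have G1 : profile k t ^+ 2 <= 1 by move: (ltW b0); rewrite /b /dprofile; lra.
pose N : R := n%:R - 2 + expR (- (2 * k)).
have N0 : 0 < N by rewrite /N; lra.
pose nu : R := (n%:R - 1) / N; pose mu : R := N^-1.
have nu1 : 1 <= nu by rewrite /nu ler_pdivlMr// /N; lra.
have nu2 : nu <= 2 by rewrite /nu ler_pdivrMr// /N; lra.
have mu0 : 0 < mu by rewrite invr_gt0.
have mu1 : mu <= 1 by rewrite /mu invf_le1// /N; lra.
set al := expR _ in al0 alb sq N N0 nu nu1 nu2 mu mu0 mu1 *.
set G := profile k t in Gt Gk sq G1.
have G0 : 0 <= G by lra.
(* [b m = a + t b] is the radial component of the flux; that of the gradient is [al G]. The factor
   [nu] arises from [(1 - al) / N + 1 = (n - 1) / N]. *)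
pose m := nu * t + 2 * k * mu * G * (1 - t ^+ 2).
have aE : a = b * m - t * b.
  by rewrite /a /flux_profile -/al -/G -/b /m /nu /mu /N; field;
    rewrite -/N lt0r_neq0.
rewrite (_ : frame_dot t a b a b = (b * m) ^+ 2 + (1 - t ^+ 2) * b ^+ 2);
  last first.
  by rewrite /frame_dot aE; ring.
rewrite (_ : frame_dot t A _ A _ =
    (al * G) ^+ 2 + (1 - t ^+ 2) * (k * b) ^+ 2); last first.
  by rewrite /frame_dot /A /grad_profile -/al -/G -/b; ring.
rewrite (_ : frame_dot t a b A _ =
  al * G * (b * m) + (1 - t ^+ 2) * k * b ^+ 2);
  last by rewrite /frame_dot /A /grad_profile -/al -/G -/b aE; ring.
have tt : 0 <= 1 - t ^+ 2 by nra.
have Gm : t * G <= G * m.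
  have h1 : t * G <= nu * (t * G) by rewrite ler_peMl// mulr_ge0.
  have h2 : 0 <= 2 * k * mu * G ^+ 2 * (1 - t ^+ 2).
    have mu0' := ltW mu0.
    by rewrite mulr_ge0// mulr_ge0 ?sqr_ge0// !mulr_ge0.
  by rewrite /m; lra.
have m2 : m ^+ 2 <= 8 * t ^+ 2 + 8 * k ^+ 2 * (1 - t ^+ 2).
  have h1 : m ^+ 2 <= 2 * (nu * t) ^+ 2 +
    2 * (2 * k * mu * G * (1 - t ^+ 2)) ^+ 2.
    by rewrite /m; set c := nu * t; set d := 2 * k * _ * _ * _;
      have := sqr_ge0 (c - d); nra.
  have h2 : (nu * t) ^+ 2 <= 4 * t ^+ 2.
    by rewrite exprMn ler_wpM2r ?sqr_ge0//; nra.
  have h3 : (2 * k * mu * G * (1 - t ^+ 2)) ^+ 2 <= 4 * k ^+ 2 * (1 - t ^+ 2).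
    rewrite (_ : _ ^+ 2 = 4 * k ^+ 2 * (1 - t ^+ 2) *
      (mu ^+ 2 * G ^+ 2 * (1 - t ^+ 2))); last by ring.
    rewrite ler_piMr ?mulr_ge0 ?sqr_ge0//.
    have mu21 : mu ^+ 2 <= 1 by rewrite expr_le1// ltW.
    have t21 : 1 - t ^+ 2 <= 1 by rewrite gerBl sqr_ge0.
    apply: mulr_ile1 => //; first by rewrite mulr_ge0 ?sqr_ge0.
    by apply: mulr_ile1; rewrite ?sqr_ge0.
  by lra.
have al0' := ltW al0; have b0' := ltW b0.
have X0 : 0 <= al * b * (t * G) by apply: mulr_ge0; apply: mulr_ge0.
have Y0 : 0 <= (1 - t ^+ 2) * k * b ^+ 2
  by rewrite mulr_ge0 ?sqr_ge0// mulr_ge0.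
set X := al * b * (t * G) in X0; set Y := (1 - t ^+ 2) * k * b ^+ 2 in Y0 *.
(* In [b^2 m^2 <= 8 t^2 b^2 + 8 k^2 (1 - t^2) b^2] the last term is [8 k Y], and the Kramers
   estimate times [8 b] turns the first into [64 X + 32 Y]. *)
have i1 : (b * m) ^+ 2 <= 64 * X + 32 * Y + 8 * k * Y.
  have := ler_wpM2l (sqr_ge0 b) m2; have := ler_wpM2l (ltW b0) sq.
  rewrite exprMn /X /Y; lra.
have i2 : (al * G) ^+ 2 <= 2 * k * X.
  rewrite (_ : 2 * k * X = al * b * (2 * k * t * G)); last by rewrite /X; ring.
  rewrite (_ : (al * G) ^+ 2 = al * al * (G * G)); last by ring.
  by apply: ler_pM; [exact: mulr_ge0|exact: mulr_ge0|exact: ler_wpM2l|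
    exact: ler_wpM2r].
have i3 : (1 - t ^+ 2) * b ^+ 2 <= Y.
  by rewrite /Y mulrAC ler_peMr// mulr_ge0 ?sqr_ge0.
have i4 : (1 - t ^+ 2) * (k * b) ^+ 2 = k * Y by rewrite /Y; ring.
have i5 : X <= al * G * (b * m).
  rewrite (_ : al * G * (b * m) = al * b * (G * m)); last by ring.
  by rewrite /X ler_wpM2l// mulr_ge0.
(* The four bounds add up to at most [66 k X + 42 k Y], well below [100 k (X + Y)]. *)
have kX : X <= k * X by rewrite ler_peMl.
have kY : Y <= k * Y by rewrite ler_peMl.
have := ler_wpM2l (_ : 0 <= 100 * k) i5; rewrite mulr_ge0// => /(_ isT) i6.
by rewrite i4; lra.
Qed.

(** Under [t -> - t] the radial coefficients are odd and the axial ones even, so each [frame_dot] is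
    invariant and [t >= 0] may be assumed. *)
Lemma flux_profile_bound (n : nat) k t : (3 <= n)%N -> 1 <= k -> `|t| <= 1 ->
  frame_dot t (flux_profile n k t) (dprofile k t)
      (flux_profile n k t) (dprofile k t) +
    frame_dot t (grad_profile k t) (k * dprofile k t)
      (grad_profile k t) (k * dprofile k t) <=
  100 * k * frame_dot t (flux_profile n k t) (dprofile k t)
      (grad_profile k t) (k * dprofile k t).
Proof.
move=> n3 k1; rewrite ler_norml => /andP[tN1 t1].
have [t0|t0] := leP 0 t; first by apply: flux_profile_bound_pos => //;
  rewrite t0.
have := @flux_profile_bound_pos n k (- t) n3 k1;
  rewrite oppr_ge0 ltW//= lerNl tN1 => /(_ isT).
rewrite flux_profileN dprofileN grad_profileN.
by rewrite /frame_dot; congr (is_true (_ <= _)); ring.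
Qed.

End flux_profile.

(** * Homogeneous functions *)

Section directional_derivative.
Context {R : realType} {V : normedModType R}.
Implicit Types (x v : V) (f : V -> R).

Lemma is_derive_lineP x v f (l : R) :
  is_derive x v f l <-> is_derive (0 : R) 1 (fun h : R => f (h *: v + x)) l.
Proof.
have E : (fun h : R => h^-1 *: ((f \o shift x) (h *: v) - f x)) =
    (fun h : R => h^-1 *: (((fun h => f (h *: v + x)) \o shift (0 : R)) (h *: 1)
      - f ((0 : R) *: v + x))).
  apply/funext => h /=.
  by rewrite addr0 scale0r add0r [h *: 1]mulr1.
split=> -[df <-]; (apply: DeriveDef; first by move: df; rewrite /derivable E);
  by rewrite /derive E.
Qed.

Lemma is_derive_comp1 x v f (g : R -> R) (l m : R) :
  is_derive x v f l -> is_derive (f x) 1 g m -> is_derive x v (g \o f) (m * l).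
Proof.
move=> /is_derive_lineP df dg; apply/is_derive_lineP.
apply: (@is_derive1_comp _ g (fun h => f (h *: v + x))) => //.
by rewrite scale0r add0r.
Qed.

End directional_derivative.

Section homogeneous_functions.
Context {R : realType} {n : nat}.
Implicit Types (x : 'rV[R]_n) (i j : 'I_n).
Local Notation e_ i := (delta_mx ord0 i : 'rV[R]_n).

Definition unit_coord j x : R := x ord0 j / enorm x.

Lemma unit_coord_le1 j x : `|unit_coord j x| <= 1.
Proof.
have [->|x0] := eqVneq x 0; first by rewrite /unit_coord mxE mul0r normr0.
rewrite /unit_coord normrM normfV (ger0_norm (enorm_ge0 x)).
by rewrite ler_pdivrMr ?enorm_gt0// mul1r coord_le_enorm.
Qed.

Lemma sum_sqr_unit_coord x : x != 0 -> \sum_j unit_coord j x ^+ 2 = 1.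
Proof.
move=> x0; under eq_bigr do rewrite /unit_coord expr_div_n expr2.
by rewrite -mulr_suml sqr_enorm divff// dotrV_eq0.
Qed.

Lemma is_derive_coord i j x :
  is_derive x (e_ i) (fun y : 'rV[R]_n => y ord0 j) (i == j)%:R.
Proof.
apply/is_derive_lineP.
rewrite (_ : (fun h : R => _) =
    (i == j)%:R \*: (@id R) + cst (x ord0 j)); last first.
  by apply/funext => h; rewrite !mxE/= eq_sym mulrC.
by apply: is_derive_eq; rewrite addr0 [_ *: _]mulr1.
Qed.

Lemma is_derive_dotrV i x :
  is_derive x (e_ i) (fun y : 'rV[R]_n => dotrV y y) (2 * x ord0 i).
Proof.
apply/is_derive_lineP.
rewrite (_ : (fun h : R => _) =
    (@id R) * (@id R) + ((2 * x ord0 i) \*: (@id R) + cst (dotrV x x)));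
      last first.
  apply/funext => h; rewrite !dotrVDl !dotrVZl !(dotrVC _ (_ +
    _)) !dotrVDl !dotrVZl.
  have dot1 (y : 'rV[R]_n) : dotrV (e_ i) y = y ord0 i.
    rewrite /dotrV (bigD1 i)//= mxE !eqxx mul1r big1 ?addr0// => j ji.
    by rewrite mxE (negbTE ji) andbF mul0r.
  rewrite (dotrVC x (e_ i)) !dot1 mxE !eqxx/=.
  by rewrite !fctE /= /GRing.scale/=; ring.
have did := is_derive_id (0 : R) (1 : R).
apply: (is_derive_eq (is_deriveD (is_deriveM did did)
  (is_deriveD (is_deriveZ (2 * x ord0 i) did)
    (is_derive_cst (dotrV x x) (0 : R) (1 : R))))).
by rewrite /GRing.scale/=; ring.
Qed.

Lemma is_derive_enorm i x : x != 0 ->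
  is_derive x (e_ i) (@enorm R n) (unit_coord i x).
Proof.
move=> x0; have r0 : 0 < enorm x by rewrite enorm_gt0.
rewrite (_ : unit_coord i x = (2 * enorm x)^-1 * (2 * x ord0 i)); last first.
  by rewrite /unit_coord; field; rewrite lt0r_neq0.
apply: (is_derive_comp1 (is_derive_dotrV i x)).
by apply: is_derive1_sqrt; rewrite dotrV_gt0.
Qed.

Lemma is_derive_unit_coord i j x : x != 0 ->
  is_derive x (e_ i) (unit_coord j)
    (((i == j)%:R - unit_coord j x * unit_coord i x) / enorm x).
Proof.
move=> x0; have r0 : 0 < enorm x by rewrite enorm_gt0.
have dV : is_derive (enorm x) 1 (fun r : R => r^-1) (- enorm x ^- 2).
  apply: is_derive_eq; first by apply: is_deriveV; exact: lt0r_neq0.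
  by rewrite [_ *: _]mulr1.
apply: (is_derive_eq (is_deriveM (is_derive_coord i j x)
  (is_derive_comp1 (is_derive_enorm i x0) dV))).
by rewrite /GRing.scale/= /unit_coord; field; rewrite lt0r_neq0.
Qed.

Lemma is_derive_powR_enorm (b : R) i x : x != 0 ->
  is_derive x (e_ i) (fun y => enorm y `^ b)
    (enorm x `^ (b - 1) * (b * unit_coord i x)).
Proof.
move=> x0; have r0 : 0 < enorm x by rewrite enorm_gt0.
rewrite mulrCA mulrA.
exact: (is_derive_comp1 (g := fun r => r `^ b) (is_derive_enorm i x0)
  (is_derive1_powR b r0)).
Qed.

Lemma powR_enorm_pred (b : R) x : x != 0 ->
  enorm x `^ b / enorm x = enorm x `^ (b - 1).
Proof.
move=> x0; have r0 : 0 < enorm x by rewrite enorm_gt0.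
by rewrite powRB ?powRr1 ?(lt0r_neq0 r0) ?implybT// ltW.
Qed.

Lemma is_derive_homogeneous (b : R) (H dH : R -> R) i j x : x != 0 ->
  (forall t : R, is_derive t 1 H (dH t)) ->
  is_derive x (e_ i) (fun y => enorm y `^ b * H (unit_coord j y))
    (enorm x `^ (b - 1) * (b * unit_coord i x * H (unit_coord j x) +
      dH (unit_coord j x) * ((i == j)%:R - unit_coord j x * unit_coord i x))).
Proof.
move=> x0 dHE; have r0 : 0 < enorm x by rewrite enorm_gt0.
apply: (is_derive_eq (is_deriveM (is_derive_powR_enorm b i x0)
  (is_derive_comp1 (is_derive_unit_coord i j x0) (dHE _)))).
by rewrite /GRing.scale/= -(powR_enorm_pred b x0); field; rewrite lt0r_neq0.
Qed.

(** The class of angular factors: a homogeneous field is a power of [|x|] times a tame function, so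
    its size near 0 is read off the exponent alone. *)
Definition tame (P : 'rV[R]_n -> R) : Prop :=
  (forall x, x != 0 -> {for x, continuous P}) /\ exists M, forall x,
    `|P x| <= M.

Lemma tame_cst (c : R) : tame (fun=> c).
Proof.
split=> [x _|]; last by exists `|c|.
exact: (@cst_continuous _ _ c x).
Qed.

Lemma tameD P Q : tame P -> tame Q -> tame (fun x => P x + Q x).
Proof.
move=> [cP [M PM]] [cQ [N QN]]; split=> [x x0|].
  by apply: continuousD; [exact: cP|exact: cQ].
by exists (M + N) => x; apply: le_trans (ler_normD _ _) _; exact: lerD.
Qed.

Lemma tameM P Q : tame P -> tame Q -> tame (fun x => P x * Q x).
Proof.
move=> [cP [M PM]] [cQ [N QN]]; split=> [x x0|].
  by apply: continuousM; [exact: cP|exact: cQ].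
by exists (M * N) => x; rewrite normrM ler_pM.
Qed.

Lemma tameB P Q : tame P -> tame Q -> tame (fun x => P x - Q x).
Proof.
move=> tP tQ; rewrite (_ : (fun x => _) = (fun x => P x + -1 * Q x)).
  by apply: tameD => //; apply: tameM => //; exact: tame_cst.
by apply/funext => x; rewrite mulN1r.
Qed.

Lemma tame_unit_coord j : tame (unit_coord j).
Proof.
split=> [x x0|]; last by exists 1; exact: unit_coord_le1.
apply: continuousM; first exact: continuous_coord_rV.
by apply: continuousV; [rewrite lt0r_neq0// enorm_gt0|exact: continuous_enorm].
Qed.

Lemma tame_comp (H : R -> R) j : continuous H ->
  tame (fun x => H (unit_coord j x)).
Proof.
move=> cH; split=> [x x0|].
  by apply: continuous_comp; [exact: (tame_unit_coord j).1|exact: cH].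
have /compact_bounded[M [_ /(_ (`|M| + 1)) HM]] : compact (H @` `[-1, 1]).
  apply: continuous_compact; last exact: segment_compact.
  exact: continuous_subspaceT.
exists (`|M| + 1) => x; apply: HM;
  first by rewrite (le_lt_trans (ler_norm _))// ltrDl.
by exists (unit_coord j x) => //; rewrite /= in_itv/= -ler_norml unit_coord_le1.
Qed.

Lemma continuous_powR_tame (b : R) P x : tame P -> x != 0 ->
  {for x, continuous (fun y => enorm y `^ b * P y)}.
Proof.
move=> [cP _] x0; apply: continuousM; last exact: cP.
apply: (@continuous_comp _ _ _ (@enorm R n) (fun r => r `^ b)).
  exact: continuous_enorm.
apply/differentiable_continuous/derivable1_diffP.
by apply: ex_derive; apply: is_derive1_powR; rewrite enorm_gt0.
Qed.

(** On the ball [|x| < 1], so [|x|^b <= |x|^-2]. The condition [b != 0] makes the left side vanish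
    at the origin, where the right side is [M / 0 = 0]. *)
Lemma powR_tame_bounded (b : R) P : -2 <= b -> b != 0 -> tame P ->
  exists M, forall x, unit_ball x -> `|enorm x `^ b * P x| <= M / dotrV x x.
Proof.
move=> b2 b0 [_ [M PM]]; exists M => x Bx.
have [->|x0] := eqVneq x 0.
  by rewrite enorm0 powR0// mul0r normr0 (eqP
    (_ : dotrV 0 0 == 0)) ?dotrV_eq0// invr0 mulr0.
have r0 : 0 < enorm x by rewrite enorm_gt0.
rewrite normrM mulrC ler_pM// (ger0_norm (powR_ge0 _ _)).
rewrite -sqr_enorm -powR_mulrn ?(ltW r0)// -powRN.
by apply: ger_powR => //; rewrite r0 ltW.
Qed.

End homogeneous_functions.

(** * Membership in Lebesgue spaces of the ball *)

Section Lp_ball.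
Context {R : realType} {n : nat}.
Local Notation B := (@unit_ball R n).
Local Notation leb := (@lebesgue_rV R n).

(** The inverse is written [f (f^2)^-1], so that a real power is applied to a nonnegative function;
    at zeros of [f] both sides are 0. *)
Lemma measurable_inv d (T : measurableType d) (f : T -> R) :
  measurable_fun setT f -> measurable_fun setT (fun x => (f x)^-1).
Proof.
move=> mf; rewrite (_ : (fun x => _) = fun x => f x * (f x ^+ 2) `^ (-1)).
  apply: measurable_funM => //.
  apply: (measurableT_comp (f := fun r => r `^ (-1))) => //.
  exact: measurable_funX.
apply/funext => x; rewrite powR_inv1 ?sqr_ge0//.
have [->|fx0] := eqVneq (f x) 0; first by rewrite mul0r invr0.
by field.
Qed.

Lemma Lp_on_2_ball (f : 'rV[R]_n -> R) (M : R) : (3 <= n)%N ->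
  measurable_fun setT f ->
  (forall x, B x -> `|f x ^+ 2| <= M / dotrV x x) -> Lp_on 2%:E B f.
Proof.
move=> n3 mf fM; have mB := @measurable_unit_ball R n.
rewrite /Lp_on inE; apply/andP; split; rewrite inE/=.
  exact/(measurable_restrictT _ mB)/measurable_funTS.
rewrite /finite_norm unlock; apply: poweR_lty.
have /integrableP[_] := integrable_inverse_square n3
  (measurable_funX 2%N mf) fM.
rewrite [X in (X < _)%E -> _]integral_mkcond; apply: le_lt_trans;
  rewrite le_eqVlt; apply/orP; left.
apply/eqP; apply: eq_integral => x _ /=; rewrite !patchE.
case: ifPn => _ /=; last first.
  by have -> : point = 0 :> R by []; rewrite normr0 powR0.
by rewrite powR_mulrn// normrX.
Qed.

Lemma Lp_on_oo_ball (f : 'rV[R]_n -> R) (M : R) :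
  measurable_fun setT f -> (forall x, B x -> `|f x| <= M) -> Lp_on +oo%E B f.
Proof.
move=> mf fM; have mB := @measurable_unit_ball R n.
rewrite /Lp_on inE; apply/andP; split; rewrite inE/=.
  exact/(measurable_restrictT _ mB)/measurable_funTS.
rewrite /finite_norm unlock; case: ifP => _; last exact: ltry.
apply: (@le_lt_trans _ _ (`|M|%:E)); last exact: ltry.
apply/ess_supP; apply: aeW => x /=; rewrite lee_fin patchE.
case: ifPn => [/set_mem /fM /le_trans|_]; first by apply; exact: ler_norm.
by rewrite normr0.
Qed.

End Lp_ball.

(** * Axially symmetric homogeneous fields and their divergence *)

Section frame_fields.
Context {R : realType} {n : nat} (i0 : 'I_n).
Implicit Types (x : 'rV[R]_n) (A B : R -> R).
Local Notation e_ i := (delta_mx ord0 i : 'rV[R]_n).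
Local Notation B1 := (@unit_ball R n).
Local Notation leb := (@lebesgue_rV R n).
Local Notation axis := (@unit_coord R n i0).

(* [|x|^b (A(t) x / |x| + B(t) e_i0)], where [t = x_i0 / |x|]. *)
Definition frame_field (b : R) A B x : 'rV[R]_n :=
  \row_i (enorm x `^ b * (A (axis x) * unit_coord i x +
    B (axis x) * (i == i0)%:R)).

Lemma dotrV_frame_field (b : R) A B C D x : b != 0 ->
  dotrV (frame_field b A B x) (frame_field b C D x) =
  (enorm x `^ b) ^+ 2 * frame_dot (axis x) (A (axis x)) (B (axis x))
    (C (axis x)) (D (axis x)).
Proof.
move=> b0; have [->|x0] := eqVneq x 0.
  rewrite enorm0 powR0// expr0n/= mul0r /dotrV big1// => i _.
  by rewrite !mxE enorm0 powR0// !mul0r.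
rewrite /dotrV /frame_dot (bigD1 i0)//= !mxE eqxx.
have := sum_sqr_unit_coord x0; rewrite (bigD1 i0)//= => S1.
rewrite (eq_bigr (fun i => (enorm x `^ b) ^+ 2 * (A (axis x) * C (axis x)) *
    unit_coord i x ^+ 2)) => [|i /negbTE ii]; last first.
  by rewrite !mxE ii mulr0n; ring.
rewrite -mulr_sumr (_ : \sum_(_ | _) _ = 1 - axis x ^+ 2); last first.
  by rewrite -S1 addrAC subrr add0r.
by ring.
Qed.

Section calculus.
Variables (b : R) (A B dA dB : R -> R).
Hypotheses (dAE : forall t : R, is_derive t 1 A (dA t))
  (dBE : forall t : R, is_derive t 1 B (dB t)).

(** The i-th diagonal entry of the Jacobian matrix of [frame_field], so that the sum over [i] is the
    divergence. *)
Definition dframe_field (i : 'I_n) x : R :=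
  enorm x `^ (b - 1) * (
    (b * unit_coord i x * A (axis x) +
      dA (axis x) * ((i == i0)%:R - axis x * unit_coord i x)) * unit_coord i x +
    A (axis x) * (1 - unit_coord i x * unit_coord i x) +
    (b * unit_coord i x * B (axis x) +
      dB (axis x) * ((i == i0)%:R - axis x * unit_coord i x)) * (i == i0)%:R).

Lemma is_derive_frame_field i x : x != 0 ->
  is_derive x (e_ i) (fun y => frame_field b A B y ord0 i) (dframe_field i x).
Proof.
move=> x0.
rewrite (_ : (fun y => _) =
    (fun y => enorm y `^ b * A (axis y)) * unit_coord i +
    (i == i0)%:R \*: (fun y => enorm y `^ b * B (axis y))); last first.
  by apply/funext => y; rewrite mxE /= !fctE/= /GRing.scale/=; ring.
apply: (is_derive_eq (is_deriveD
  (is_deriveM (is_derive_homogeneous b i i0 x0 dAE)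
    (is_derive_unit_coord i i x0))
  (is_deriveZ (i == i0)%:R (is_derive_homogeneous b i i0 x0 dBE)))).
rewrite /dframe_field -(powR_enorm_pred b x0) /GRing.scale/= eqxx mulr1n.
by field; rewrite lt0r_neq0// enorm_gt0.
Qed.

(** No [dA] survives: the gradient of the angular variable is orthogonal to the radial direction.
    The [dB] term keeps the factor [1 - t^2] from the axial derivative of [t]. *)
Lemma sum_dframe_field x : x != 0 ->
  \sum_i dframe_field i x = enorm x `^ (b - 1) *
    ((b + n%:R - 1) * A (axis x) + b * axis x * B (axis x) +
     (1 - axis x ^+ 2) * dB (axis x)).
Proof.
move=> x0; have := sum_sqr_unit_coord x0; rewrite (bigD1 i0)//= => S1.
rewrite /dframe_field -mulr_sumr; congr (_ * _);
  rewrite (bigD1 i0)//= eqxx mulr1n.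
rewrite (eq_bigr (fun i => A (axis x) + ((b - 1) * A (axis x) -
    dA (axis x) * axis x) * unit_coord i x ^+ 2)) => [|i /negbTE ii];
      last first.
  by rewrite ii mulr0n; ring.
rewrite big_split/= -mulr_sumr sumr_const -[A _ *+ _]mulr_natr.
rewrite (_ : \sum_(_ | _) _ = 1 - axis x ^+ 2);
  last by rewrite -S1 addrAC subrr add0r.
rewrite (_ : #|_|%:R = n%:R - 1); last first.
  rewrite (eq_card (B := predC1 i0))// cardC1 card_ord -subn1 natrB//.
  exact: leq_ltn_trans (ltn_ord i0).
by ring.
Qed.

End calculus.
End frame_fields.

(** * The solution and its flux *)

Lemma is_derive1_continuous {R : realType} (H dH : R -> R) :
  (forall t : R, is_derive t 1 H (dH t)) -> continuous H.
Proof.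
by move=> HE t; apply/differentiable_continuous/derivable1_diffP; case: (HE t).
Qed.

Section profile_derivatives.
Context {R : realType}.
Implicit Types k t : R.

Lemma is_derive_dprofile k t :
  is_derive t 1 (dprofile k) (- 2 * profile k t * (k * dprofile k t)).
Proof.
rewrite [X in is_derive _ _ X _](_ : _ = cst 1 - profile k * profile k);
  last first.
  by apply/funext => s; rewrite /dprofile expr2.
have dG := is_derive_profile k t.
apply: (is_derive_eq (is_deriveB (is_derive_cst (1 : R) t (1 : R))
  (is_deriveM dG dG))).
by rewrite /GRing.scale/=; ring.
Qed.

Definition dflux_profile (n : nat) k t : R :=
  let b := dprofile k t in let G := profile k t in
  let db := - 2 * G * (k * b) in
  ((1 - expR (- (2 * k))) * (b + t * db) +
    2 * k * ((k * b * b + G * db) * (1 - t * t) - G * b * (2 * t))) /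
  (n%:R - 2 + expR (- (2 * k))).

Lemma is_derive_flux_profile n k t :
  is_derive t 1 (flux_profile n k) (dflux_profile n k t).
Proof.
set N := n%:R - 2 + expR (- (2 * k)); set c := 1 - expR (- (2 * k)).
have dG := is_derive_profile k t; have db := is_derive_dprofile k t.
have did := is_derive_id t (1 : R).
rewrite (_ : flux_profile n k = N^-1 \*: (c \*: (@id R * dprofile k) +
    (2 * k) \*: (profile k * dprofile k * (cst 1 - @id R * @id R))));
      last first.
  apply/funext => s; rewrite /flux_profile -/N -/c expr2 !fctE/= /GRing.scale/=.
  by rewrite mulrC; congr (_ * _); ring.
apply: (is_derive_eq (is_deriveZ N^-1 (is_deriveD
  (is_deriveZ c (is_deriveM did db))
  (is_deriveZ (2 * k) (is_deriveM (is_deriveM dG db)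
    (is_deriveB (is_derive_cst (1 : R) t (1 : R)) (is_deriveM did did))))))).
rewrite /dflux_profile -/N -/c !fctE/= /GRing.scale/= mulrC; congr (_ * _).
by rewrite /cst/=; ring.
Qed.

End profile_derivatives.

Lemma Lp_on_2_powR_tame {R : realType} {n : nat} (b : R) (P : 'rV[R]_n -> R) :
  (3 <= n)%N -> -1 <= b -> b != 0 -> tame P ->
  Lp_on 2%:E unit_ball (fun x => enorm x `^ b * P x).
Proof.
move=> n3 b1 b0 tP.
have b20 : b + b != 0 by rewrite -mulr2n mulrn_eq0.
have bb : -2 <= b + b by lra.
have [M PM] := powR_tame_bounded bb b20 (tameM tP tP).
apply: (Lp_on_2_ball n3 (M := M)) => [|x Bx].
  by apply: measurable_fun_continuous_off0 => x; exact: continuous_powR_tame.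
rewrite (_ : _ ^+ 2 = enorm x `^ (b + b) * (P x * P x)); first exact: PM.
by rewrite powRD ?(negbTE b20)//; ring.
Qed.

Section solution.
Context {R : realType} {n : nat} (i0 : 'I_n) (k : R).
Hypotheses (n3 : (3 <= n)%N) (k1 : 1 <= k).
Local Notation B := (@unit_ball R n).
Local Notation leb := (@lebesgue_rV R n).
Local Notation al := (expR (- (2 * k))).
Local Notation axis := (@unit_coord R n i0).

Definition sol (x : 'rV[R]_n) : R := enorm x `^ al * profile k (axis x).

Definition dsol : 'rV[R]_n -> 'rV[R]_n :=
  frame_field i0 (al - 1) (grad_profile k) (fun t => k * dprofile k t).

Definition flux : 'rV[R]_n -> 'rV[R]_n :=
  frame_field i0 (al - 1) (flux_profile n k) (dprofile k).

Definition dflux (i : 'I_n) : 'rV[R]_n -> R :=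
  dframe_field i0 (al - 1) (flux_profile n k) (dprofile k) (dflux_profile n k)
    (fun t => - 2 * profile k t * (k * dprofile k t)) i.

Let al0 : 0 < al. Proof. exact: expR_gt0. Qed.

Let al1 : al < 1.
Proof. by rewrite -[ltRHS]expR0 ltr_expR; have := k1; lra. Qed.

Let tame_profile : tame (fun x : 'rV[R]_n => profile k (axis x)).
Proof. apply: tame_comp; exact: (is_derive1_continuous (is_derive_profile _)).
  Qed.

Let tame_dprofile : tame (fun x : 'rV[R]_n => dprofile k (axis x)).
Proof. apply: tame_comp; exact: (is_derive1_continuous
  (is_derive_dprofile _)). Qed.

Let tame_flux_profile : tame (fun x : 'rV[R]_n => flux_profile n k (axis x)).
Proof. apply: tame_comp; exact: (is_derive1_continuous
  (is_derive_flux_profile n k)). Qed.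

Ltac tame_tac := lazymatch goal with
  | |- tame (fun x => @?P x - @?Q x) => apply: (@tameB _ _ P Q); tame_tac
  | |- tame (fun x => @?P x + @?Q x) => apply: (@tameD _ _ P Q); tame_tac
  | |- tame (fun x => @?P x * @?Q x) => apply: (@tameM _ _ P Q); tame_tac
  | |- tame (fun=> ?c) => exact: (tame_cst c)
  | |- _ => first [ exact: tame_profile | exact: tame_dprofile
                  | exact: tame_flux_profile | exact: tame_unit_coord ]
  end.

Let tame_dsol i : tame (fun x => grad_profile k (axis x) * unit_coord i x +
  k * dprofile k (axis x) * (i == i0)%:R).
Proof. by rewrite /grad_profile; tame_tac. Qed.

Let dsolE i : (fun x => dsol x ord0 i) = (fun x => enorm x `^ (al - 1) *
  (grad_profile k (axis x) * unit_coord i x +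
    k * dprofile k (axis x) * (i == i0)%:R)).
Proof. by apply/funext => x; rewrite mxE. Qed.

Let tame_flux i : tame (fun x => flux_profile n k (axis x) * unit_coord i x +
  dprofile k (axis x) * (i == i0)%:R).
Proof. by tame_tac. Qed.

Let fluxE i : (fun x => flux x ord0 i) = (fun x => enorm x `^ (al - 1) *
  (flux_profile n k (axis x) * unit_coord i x +
    dprofile k (axis x) * (i == i0)%:R)).
Proof. by apply/funext => x; rewrite mxE. Qed.

Let tame_dflux i : exists2 P,
  tame P & dflux i = (fun x => enorm x `^ (al - 1 - 1) * P x).
Proof.
eexists; last by rewrite /dflux /dframe_field; reflexivity.
rewrite /dflux_profile /=.
by tame_tac.
Qed.

(** The exponents [al], [al - 1], [al - 2] of the solution, its gradient and the derivatives of the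
    flux are nonzero, so all these fields vanish at the origin as [0] to a nonzero power is 0; and
    all are at least -2. *)
Let al_neq0 : al != 0. Proof. exact: lt0r_neq0. Qed.
Let al1_neq0 : al - 1 != 0. Proof. by rewrite subr_eq0 lt_eqF. Qed.
Let al2_neq0 : al - 1 - 1 != 0.
Proof. by have := al1; move=> ?; apply/eqP; lra. Qed.

Lemma is_derive_sol i x : x != 0 ->
  is_derive x (delta_mx ord0 i) sol (dsol x ord0 i).
Proof.
move=> x0.
apply: (is_derive_eq (is_derive_homogeneous al i i0 x0 (is_derive_profile k))).
by rewrite mxE /grad_profile; congr (_ * _); ring.
Qed.

Lemma is_derive_flux i x : x != 0 ->
  is_derive x (delta_mx ord0 i) (fun y => flux y ord0 i) (dflux i x).
Proof.
exact: (is_derive_frame_field i0 (al - 1) (is_derive_flux_profile n k)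
  (is_derive_dprofile k) i).
Qed.

(** For the exponent [al - 1] the coefficient of the radial profile is exactly the denominator of
    [flux_profile], and its numerator cancels the two axial terms. *)
Lemma sum_dflux x : \sum_i dflux i x = 0.
Proof.
have [->|x0] := eqVneq x 0.
  by rewrite big1// => i _; rewrite /dflux /dframe_field enorm0 powR0// mul0r.
rewrite sum_dframe_field// /flux_profile.
have n3' : (3 : R) <= n%:R by rewrite ler_nat.
have a0 := al0; set N := n%:R - 2 + al.
have N0 : N != 0 by rewrite lt0r_neq0// /N; lra.
rewrite (_ : al - 1 + n%:R - 1 = N); last by rewrite /N; ring.
by rewrite [N * _]mulrC (divfK N0) -[RHS](mulr0 (enorm x `^ (al - 1 - 1)));
  congr (_ * _); ring.
Qed.

Lemma sobolev_sol : sobolev12_grad B sol dsol.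
Proof.
have a0 := al0; have a1 := al1; split.
- by apply: Lp_on_2_powR_tame => //; lra.
- by move=> i; rewrite dsolE; apply: Lp_on_2_powR_tame => //; lra.
move=> phi tphi i.
have [M solM] : exists M, forall x, B x -> `|sol x| <= M / dotrV x x.
  by apply: powR_tame_bounded => //; lra.
have [N dsolN] : exists N, forall x, B x -> `|dsol x ord0 i| <= N / dotrV x x.
  have [|N PN] := powR_tame_bounded _ al1_neq0 (tame_dsol i); first by lra.
  by exists N => x Bx; rewrite mxE; exact: PN.
have cs x : x != 0 -> {for x, continuous sol} by exact: continuous_powR_tame.
have cd x : x != 0 -> {for x, continuous (fun y => dsol y ord0 i)}.
  by rewrite dsolE; exact: continuous_powR_tame.
by have [] := integration_by_parts_ball n3 cs cd
  (is_derive_sol i) solM dsolN tphi.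
Qed.

Lemma measurable_dsol i : measurable_fun setT (fun x => dsol x ord0 i).
Proof.
apply: measurable_fun_continuous_off0 => x x0; rewrite dsolE.
exact: continuous_powR_tame.
Qed.

Lemma measurable_flux i : measurable_fun setT (fun x => flux x ord0 i).
Proof.
apply: measurable_fun_continuous_off0 => x x0; rewrite fluxE.
exact: continuous_powR_tame.
Qed.

(** Integration by parts in each coordinate, summed over [i], leaves minus the integral of [zeta]
    times the divergence of the flux, which is 0. *)
Lemma weak_flux zeta : test_function B zeta ->
  (\int[leb]_(x in B) (dotrV (flux x) (grad zeta x))%:E = 0)%E.
Proof.
move=> tz; have mB := @measurable_unit_ball R n.
have a0 := al0; have a1 := al1.
have ibp i : [/\ leb.-integrable B (fun x =>
  (flux x ord0 i * partial i zeta x)%:E),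
    leb.-integrable B (fun x => (dflux i x * zeta x)%:E) &
    (\int[leb]_(x in B) (flux x ord0 i * partial i zeta x)%:E =
     - \int[leb]_(x in B) (dflux i x * zeta x)%:E)%E].
  have [M fluxM] : exists M, forall x, B x -> `|flux x ord0 i| <= M / dotrV x x.
    have [|N PN] := powR_tame_bounded _ al1_neq0 (tame_flux i); first by lra.
    by exists N => x Bx; rewrite mxE; exact: PN.
  have [P tP dfluxE] := tame_dflux i.
  have [N dfluxN] : exists N, forall x, B x -> `|dflux i x| <= N / dotrV x x.
    by rewrite dfluxE; apply: powR_tame_bounded => //; lra.
  have cF x : x != 0 -> {for x, continuous (fun y => flux y ord0 i)}.
    by rewrite fluxE; exact: continuous_powR_tame.
  have cdF x : x != 0 -> {for x, continuous (dflux i)}.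
    by rewrite dfluxE; exact: continuous_powR_tame.
  exact: (integration_by_parts_ball n3 cF cdF
    (is_derive_flux i) fluxM dfluxN tz).
have i1 i : leb.-integrable B (fun x => (flux x ord0 i * partial i zeta x)%:E).
  by case: (ibp i).
have i2 i : leb.-integrable B (fun x => (dflux i x * zeta x)%:E)
  by case: (ibp i).
transitivity (\int[leb]_(x in B) \sum_i
  (flux x ord0 i * partial i zeta x)%:E)%E.
  apply: eq_integral => x _; rewrite sumEFin; congr EFin.
  by apply: eq_bigr => i _; rewrite [grad _ _ _ _]mxE.
rewrite integral_sum//.
transitivity (- \sum_i \int[leb]_(x in B) (dflux i x * zeta x)%:E)%E.
  rewrite -fin_num_sumeN => [|i _]; last exact: integrable_fin_num.
  by apply: eq_bigr => i _; case: (ibp i).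
rewrite -integral_sum//.
rewrite (_ : (\int[leb]_(x in B) _)%E = 0%E) ?oppe0//.
transitivity (\int[leb]_(x in B) cst 0%E x)%E; last exact: integral0.
apply: eq_integral => x _; rewrite sumEFin -mulr_suml sum_dflux.
by rewrite mul0r.
Qed.

Lemma flux_bound x : dotrV (flux x) (flux x) + dotrV (dsol x) (dsol x) <=
  100 * k * dotrV (flux x) (dsol x).
Proof.
rewrite !dotrV_frame_field// -mulrDr mulrCA ler_wpM2l ?sqr_ge0//.
by apply: flux_profile_bound => //; exact: unit_coord_le1.
Qed.

Lemma sol_gt0 (x : 'rV[R]_n) : 0 < x ord0 i0 -> 0 < sol x.
Proof.
move=> xi; have x0 : x != 0 by apply: contraTneq xi => ->; rewrite mxE ltxx.
have r0 : 0 < enorm x by rewrite enorm_gt0.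
rewrite mulr_gt0 ?powR_gt0//.
have t0 : 0 < axis x by rewrite divr_gt0.
have /(profile_ge_half k1)/andP[+ _] : 0 <= axis x <= 1.
  rewrite ltW//=; apply: le_trans (ler_norm _) _; exact: unit_coord_le1.
by apply: lt_le_trans; rewrite divr_gt0.
Qed.

Lemma pos_homogeneous_sol : pos_homogeneous B al sol.
Proof.
move=> t x t0 x0 _ _; rewrite /sol enormZ (gtr0_norm t0).
rewrite powRM ?enorm_ge0 ?ltW// -mulrA; congr (_ * (_ * profile k _)).
rewrite /unit_coord enormZ (gtr0_norm t0) mxE; field.
by rewrite !lt0r_neq0// enorm_gt0.
Qed.

Lemma sol_not_ae0 : ~ (\forall x \ae leb, B x -> sol x = 0).
Proof.
have n0 : (0 : R) < n%:R by rewrite ltr0n (leq_trans _ n3).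
(* On the cube of side interval [[d/2, d]] one has [|x|^2 <= n d^2 = 1/n < 1], so it lies in the
   ball; it has positive measure, and [sol] is positive on it. *)
pose d : R := n%:R^-1; have d0 : 0 < d by rewrite invr_gt0.
pose I : set (measurableTypeR R) := `[d / 2, d]%classic.
pose Q := [set x : 'rV[R]_n | forall i, I (x ord0 i)].
have mI : measurable I by exact: measurable_itv.
have mQ : measurable Q by exact: (@measurable_box R n (fun=> I)).
have QE : leb Q = ((d / 2) ^+ n)%:E.
  transitivity (\prod_(i < n) (d / 2)%:E)%E;
    last by rewrite prodEFin prodr_const card_ord.
  rewrite /Q (@lebesgue_rV_box R n (fun=> I))//.
  apply: eq_bigr => i _.
  rewrite lebesgue_measure_itv/= lte_fin ifT; last by lra.
  by rewrite -EFinB; congr EFin; field.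
move=> [N [mN N0 subN]].
have : (leb Q <= leb N)%E.
  apply: le_measure; rewrite ?inE// => x Qx; apply: subN => /= H.
  have xi i : d / 2 <= x ord0 i <= d by have := Qx i; rewrite /I/= in_itv.
  have : 0 < sol x.
    by apply: sol_gt0; have /andP[+ _] := xi i0; apply: lt_le_trans;
      rewrite divr_gt0.
  rewrite H ?ltxx// /unit_ball /=.
  rewrite -(@ltr_pXn2r _ 2)// ?nnegrE ?enorm_ge0// sqr_enorm expr1n.
  apply: (@le_lt_trans _ _ (\sum_(i < n) d ^+ 2)).
    apply: ler_sum => i _; rewrite -expr2; have /andP[xl xu] := xi i.
    by rewrite lerXn2r ?nnegrE//; lra.
  rewrite sumr_const card_ord -mulr_natl expr2 mulrA divff ?lt0r_neq0// mul1r.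
  by rewrite invf_lt1// ltr1n (leq_trans _ n3).
by rewrite N0 QE lee_fin leNgt exprn_gt0// divr_gt0.
Qed.

End solution.

Theorem theorem1p1 (R : realType) (n : nat) (hn : (3 <= n)%N) :
  exists C c : R, [/\ 0 < C, 0 < c &
    forall gamma : R, 1 <= gamma ->
    let K := C * gamma in
    let B : set 'rV[R]_n := unit_ball in
    exists (A : 'rV[R]_n -> 'M[R]_n) (alpha : R) (u : 'rV[R]_n -> R),
      (Linfty_sym B A /\ elliptic B A K) /\
      0 < alpha /\
      [/\ pos_homogeneous B alpha u,
          sobolev12 B u,
          ~ (\forall x \ae @lebesgue_rV R n, B x -> u x = 0) &
          weak_solution B A u] /\
      alpha <= expR (- c * K)].
Proof.
(* The flux inequality holds with [L = 100 k], and ellipticity costs a factor 3, so [K = 300 k].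
   Then [c = 1/150] makes [c K = 2k], and [alpha = exp (- 2k)] attains the bound. *)
exists 300%:R, 150%:R^-1; split; rewrite ?invr_gt0 ?ltr0n//.
move=> k k1 K B.
have n0 : (0 < n)%N by exact: leq_trans hn.
pose i0 := Ordinal n0; pose p := dsol i0 k; pose F := flux i0 k.
pose L : R := 100 * k.
have L1 : 1 <= L by rewrite /L; lra.
have pF x : dotrV (F x) (F x) + dotrV (p x) (p x) <= L * dotrV (F x) (p x).
  exact: flux_bound.
have KE : K = 3 * L by rewrite /K /L; ring.
exists (fun x => two_vector_mx L (p x) (F x)), (expR (- (2 * k))), (sol i0 k).
split; first split.
- split=> [i j|x _]; last exact: trmx_two_vector_mx.
  apply: (@Lp_on_oo_ball _ _ _ (3 * L)) => [|x _];
    last exact: two_vector_mx_bounded.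
  under eq_fun do rewrite mxE.
  have mF l : measurable_fun setT (fun x => F x ord0 l).
    exact: measurable_flux.
  have mp l : measurable_fun setT (fun x => p x ord0 l).
    exact: measurable_dsol.
  have mdot (f g : 'rV[R]_n -> 'rV[R]_n) :
      (forall l, measurable_fun setT (fun x => f x ord0 l)) ->
      (forall l, measurable_fun setT (fun x => g x ord0 l)) ->
      measurable_fun setT (fun x => dotrV (f x) (g x)).
    by move=> mf mg; apply: measurable_sum => l; exact: measurable_funM.
  apply: measurable_funD.
    apply: measurable_funM; first exact: measurable_funM.
    by apply: measurable_inv; exact: mdot.
  apply: measurable_funM => //; apply: measurable_funB => //.
  apply: measurable_funM; first exact: measurable_funM.
  by apply: measurable_inv; exact: mdot.
- by apply: aeW => x _ v; rewrite KE; exact: two_vector_mx_elliptic.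
split; first exact: expR_gt0.
split; last by rewrite ler_expR /K; lra.
split.
- exact: pos_homogeneous_sol.
- by exists p; exact: sobolev_sol.
- exact: sol_not_ae0.
exists p; first exact: sobolev_sol.
move=> zeta tz.
(* Pointwise [A Du] is the flux, so the equation reduces to its weak divergence being zero. *)
under eq_integral do rewrite two_vector_mx_flux//.
exact: weak_flux.
Qed.
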